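(* For every $\varepsilon>0$ there is a constant $C_\varepsilon$ such that the following holds. Let $n\ge 1$, let $A=\{a_1,\ldots,a_n\}$ be a set of $n$ distinct real numbers and let $B=\{b_1,\ldots,b_n\}$ be a multiset of $n$ real numbers with $M(B)>0$. If $\pi$ is a uniformly random permutation of $\{1,\ldots,n\}$, then \[Q\Big[\sum_{i=1}^n a_i b_{\pi(i)}\Big]\le \frac{C_\varepsilon\, n^{-1+\varepsilon}}{\sqrt{M(B)}}.\] (In the paper's notation: $Q\big[\sum_i a_i b_{\pi(i)}\big]\le \frac{1}{n^{1-o(1)}\sqrt{M(B)}}$.)
   Context: For a random variable $X$, $Q[X]=\sup_x \mathbb{P}[X=x]$. For a multiset $B$ of $n$ reals, its multiplicity profile $\mu(B)=(\mu_1,\ldots,\mu_\ell)$ is the partition of $n$ such that the $\ell$ distinct elements of $B$ occur with multiplicities $\mu_1\ge\cdots\ge\mu_\ell$, and $M(B)=\sum_{i=1}^{\ell}(i-1)^2\mu_i$. (So $M(B)>0$ iff $B$ has at least two distinct elements.) *)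

(* Defs.v *)
From HB Require Import structures.
From mathcomp Require Import all_boot all_order all_algebra all_fingroup.
From mathcomp Require Import all_classical all_reals all_analysis.
Set Implicit Arguments. Unset Strict Implicit. Unset Printing Implicit Defensive.
Import Order.TTheory GRing.Theory Num.Theory.
Local Open Scope ring_scope.
Local Open Scope classical_set_scope.

Section Defs.
Variables (R : realType) (n : nat).

Definition perm_sum (a b : 'I_n -> R) (pi : 'S_n) : R :=
  \sum_(i < n) a i * b (pi i).

Definition prob_eq (X : 'S_n -> R) (x : R) : R :=
  (#|[set pi : 'S_n | X pi == x]|)%:R / (#|'S_n|)%:R.

Definition Qconc (X : 'S_n -> R) : R := sup (range (prob_eq X)).

Definition distinct_vals (b : 'I_n -> R) : seq R := undup (codom b).

Definition mult_profile (b : 'I_n -> R) : seq nat :=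
  sort geq [seq count_mem v (codom b) | v <- distinct_vals b].

(* M(B) = sum_{i=1}^{l} (i-1)^2 mu_i  (here 0-indexed: sum_{j<l} j^2 mu_(j+1)) *)
Definition Mprof (b : 'I_n -> R) : nat :=
  \sum_(j < size (mult_profile b)) j ^ 2 * nth 0 (mult_profile b) j.

End Defs.

(* Main.v *)
Require Import Defs.
From HB Require Import structures.
From mathcomp Require Import all_boot all_order all_algebra all_fingroup.
From mathcomp Require Import all_classical all_reals all_analysis.
From mathcomp Require Import ring lra zify complex.
Set Implicit Arguments. Unset Strict Implicit. Unset Printing Implicit Defensive.
Import Order.TTheory GRing.Theory Num.Theory numFieldNormedType.Exports.
Local Open Scope ring_scope.

(** Up to a logarithm, [M(B)] is [k^3 m] for some [k], [m] such that [k + 1]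
    distinct values occur at least [m] times each.  Pairing the [i]-th smallest of
    these values with the [i]-th largest gives about [k m] disjoint pairs of
    positions, with about [k] distinct gaps [delta].  Exchanging the entries of each
    pair with probability 1/2 turns the sum into a Rademacher sum with steps
    [(a - a') delta].

    The pairs are dealt into [h = O(log n)] groups.  On the Fourier side,
    [|cos x| <= (3 + cos 2x)/4] and the AM-GM inequality inside each group dominate
    the concentration of the Rademacher sum by that of a sum of [q ~ k m / h]
    independent copies of a lazy sum [Y] of one random step from each group; an
    antichain argument bounds the latter by [O(q^{-1/2} P(Y = 0))].

    Averaged over the permutation, [Y] becomes a lazy sum of [h] independent terms
    [(a - a') delta], and [P(Y = 0) = O(1/(n k))]: cut the sorted gaps into chunks of
    bounded size.  By Cauchy-Schwarz the eighth power of the characteristic function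
    of a term is controlled by equations [w + x y + x' delta' = 0] with
    [|x| <= |x'|], where [y] is a difference inside a chunk and [delta'] lies in a
    chunk at least as long as that of [y].  Then [delta'] is confined to an interval
    which meets at most three such chunks, and [delta'] determines [x].

    Characters of the reals enter only through the mean value of finite
    combinations of the functions [cos (x t)]. *)

(** * Uniform averages over finite types *)

Section Average.
Variable R : realType.

(** Over an empty type the value is 0, by the convention on division; hence the nonemptiness in
    [avg_cst] and the sign condition in [avg_le]. *)
Definition avg (T : finType) (F : T -> R) : R := (\sum_x F x) / #|T|%:R.

Lemma eq_avg (T : finType) (F F' : T -> R) : F =1 F' -> avg F = avg F'.
Proof. by move=> e; rewrite /avg (eq_bigr _ (fun x _ => e x)). Qed.

Lemma ler_avg (T : finType) (F F' : T -> R) :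
  (forall x, F x <= F' x) -> avg F <= avg F'.
Proof. by move=> le; rewrite ler_wpM2r ?invr_ge0 ?ler0n// ler_sum. Qed.

Lemma avg_ge0 (T : finType) (F : T -> R) : (forall x, 0 <= F x) -> 0 <= avg F.
Proof. by move=> F0; rewrite mulr_ge0 ?invr_ge0 ?ler0n// sumr_ge0. Qed.

Lemma avg_le (T : finType) (F : T -> R) (c : R) :
  0 <= c -> (forall x, F x <= c) -> avg F <= c.
Proof.
move=> c0 Fc; rewrite /avg; have [T0|T0] := posnP #|T|.
  by rewrite T0 invr0 mulr0.
rewrite ler_pdivrMr ?ltr0n//; apply: (le_trans (ler_sum _ (fun x _ => Fc x))).
by rewrite sumr_const mulr_natr cardT -cardE.
Qed.

Lemma avg_geN1 (T : finType) (F : T -> R) : (forall x, -1 <= F x) -> -1 <= avg F.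
Proof.
move=> F1; rewrite -lerN2 opprK.
have -> : - avg F = avg (fun x => - F x).
  by rewrite /avg sumrN mulNr.
by apply: avg_le => // x; rewrite lerNl.
Qed.

Lemma avg_cst (T : finType) (c : R) : (0 < #|T|)%N -> avg (fun _ : T => c) = c.
Proof.
by move=> T0; rewrite /avg sumr_const -[c *+ _]mulr_natr mulfK// pnatr_eq0 -lt0n.
Qed.

Lemma avgZ (T : finType) (c : R) (F : T -> R) :
  avg (fun x => c * F x) = c * avg F.
Proof. by rewrite /avg -mulr_sumr mulrA. Qed.

Lemma avgZr (T : finType) (c : R) (F : T -> R) :
  avg (fun x => F x * c) = avg F * c.
Proof. by rewrite mulrC -avgZ; apply: eq_avg => x; rewrite mulrC. Qed.

Lemma avgD (T : finType) (F F' : T -> R) :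
  avg (fun x => F x + F' x) = avg F + avg F'.
Proof. by rewrite /avg big_split mulrDl. Qed.

Lemma avg_exchange (T U : finType) (F : T -> U -> R) :
  avg (fun x => avg (F x)) = avg (fun y => avg (fun x => F x y)).
Proof.
rewrite /avg -!mulr_suml exchange_big /= -!mulrA; congr (_ * _).
by rewrite mulrC.
Qed.

Lemma avg_pair (T U : finType) (F : T * U -> R) :
  avg F = avg (fun x => avg (fun y => F (x, y))).
Proof.
rewrite /avg -!mulr_suml card_prod natrM invfM [#|T|%:R^-1 * _]mulrC mulrA.
by rewrite pair_bigA /=; congr (_ / _ / _); apply: eq_bigr => -[].
Qed.

(** Independence of the coordinates of a uniform random function. *)
Lemma avg_ffun (I T : finType) (F : I -> T -> R) :
  avg (fun w : {ffun I -> T} => \prod_i F i (w i)) = \prod_i avg (F i).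
Proof.
rewrite /avg -(bigA_distr_bigA F) /= card_ffun natrX big_split /=.
by rewrite prodr_const exprVn.
Qed.

(** The variance is nonnegative; all later uses of Cauchy-Schwarz on averages go through this. *)
Lemma sqr_avg_le (T : finType) (F : T -> R) :
  avg F ^+ 2 <= avg (fun x => F x ^+ 2).
Proof.
have [T0|T0] := posnP #|T|.
  by rewrite /avg T0 invr0 !mulr0 expr0n.
have : 0 <= avg (fun x => (F x - avg F) ^+ 2).
  by apply: avg_ge0 => x; rewrite sqr_ge0.
rewrite (@eq_avg _ _ (fun x => F x ^+ 2 + (- (2 * avg F)) * F x + avg F ^+ 2)).
  by rewrite !avgD avgZ avg_cst//; lra.
by move=> x; ring.
Qed.

Lemma avg_reindex (T U : finType) (h : T -> U) (F : U -> R) :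
  bijective h -> avg (fun x => F (h x)) = avg F.
Proof.
move=> bh; rewrite /avg (bij_eq_card bh); congr (_ / _).
by rewrite [RHS](reindex h)//; exact: onW_bij.
Qed.

Lemma avg_bool (F : bool -> R) : avg F = (F true + F false) / 2.
Proof. by rewrite /avg big_bool card_bool. Qed.

Lemma avg_indic (T : finType) (P : pred T) :
  avg (fun x => (P x)%:R) = #|[pred x | P x]|%:R / #|T|%:R.
Proof.
rewrite /avg; congr (_ / _).
by rewrite -sum1_card natr_sum [RHS]big_mkcond /=; apply: eq_bigr => x _; rewrite inE; case: (P x).
Qed.

End Average.

(** * Mean values of finite cosine sums *)

Section TrigMean.
Variable R : realType.
Implicit Types (f g : R -> R) (s : seq (R * R)).

Definition trig_eval s (t : R) : R := \sum_(p <- s) p.1 * cos (p.2 * t).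
(** The mean value, that is the limit of 1/T times the integral over [0, T], read off algebraically
    as the coefficient at frequency zero. *)
Definition trig_mean0 s : R := \sum_(p <- s | p.2 == 0) p.1.

Definition antider (x t : R) : R := if x == 0 then t else sin (x * t) / x.

Lemma antider_derive (x t : R) : is_derive t (1 : R) (antider x) (cos (x * t)).
Proof.
rewrite /antider; case: eqP => [->|/eqP x0].
  rewrite mul0r cos0; exact: is_derive_id.
have h1 : is_derive t (1 : R) (fun t : R => x * t) x.
  have := @is_deriveZ _ _ _ id x t 1 1 (is_derive_id _ _).
  by rewrite /GRing.scale /= mulr1.
have h2 := is_derive_sin (x * t).
have h3 := @is_derive1_comp _ sin (fun t : R => x * t) t _ _ h2 h1.
have h4 := @is_deriveZ _ _ _ _ x^-1 t 1 _ h3.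
have -> : (fun t0 : R => sin (x * t0) / x) = x^-1 \*: (sin \o (fun t => x * t)).
  by apply/funext => u /=; rewrite /GRing.scale/= mulrC.
have -> : cos (x * t) = x^-1 *: (cos (x * t) * x).
  by rewrite /GRing.scale/= mulrCA mulVf// mulr1.
exact: h4.
Qed.

Lemma trig_antider_derive s (t : R) :
  is_derive t (1 : R) (fun u => \sum_(p <- s) p.1 * antider p.2 u) (trig_eval s t).
Proof.
rewrite /trig_eval; elim: s => [|p s IH].
  rewrite big_nil.
  have -> : (fun u : R => \sum_(p <- [::]) p.1 * antider p.2 u) = cst (0 : R).
    by apply/funext => u; rewrite big_nil.
  exact: is_derive_cst.
rewrite big_cons.
have -> : (fun u : R => \sum_(q <- p :: s) q.1 * antider q.2 u) =
  (p.1 \*: antider p.2) + (fun u : R => \sum_(q <- s) q.1 * antider q.2 u).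
  by apply/funext => u; rewrite big_cons.
apply: is_deriveD; apply: is_deriveZ; exact: antider_derive.
Qed.

(** The antiderivative [F] with [F 0 = 0] is nondecreasing, hence nonnegative for positive T. The
    terms of nonzero frequency in it stay bounded, so [F T] is at most [trig_mean0 s * T + B]; a
    negative mean would be contradicted for large T. *)
Lemma trig_mean0_ge0 s : (forall t, 0 <= trig_eval s t) -> 0 <= trig_mean0 s.
Proof.
move=> ge0; set F := fun u => \sum_(p <- s) p.1 * antider p.2 u.
have dF t : derivable F t 1 by case: (trig_antider_derive s t).
have vF t : 'D_1 F t = trig_eval s t by case: (trig_antider_derive s t).
have F0 : F 0 = 0.
  rewrite /F big1// => p _; rewrite /antider mulr0 sin0 mul0r; case: ifP => _;
  by rewrite mulr0.
have FT (T : R) : 0 < T -> 0 <= F T.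
  move=> T0; rewrite -F0; apply: (@ger0_derive1_le_cc _ F 0 T);
    rewrite ?in_itv /= ?lexx ?ltW//.
  - by move=> x _; rewrite derive1E vF.
  - apply: continuous_subspaceT => x; apply/differentiable_continuous/derivable1_diffP.
    exact: dF.
pose B := \sum_(p <- s) `|p.1 / p.2|.
have B0 : 0 <= B by apply: sumr_ge0.
have FB (T : R) : 0 < T -> F T <= trig_mean0 s * T + B.
  move=> T0; rewrite /F /trig_mean0 /B mulr_suml [X in _ <= X + _]big_mkcond -big_split /=.
  apply: ler_sum => p _; rewrite /antider; case: ifP => p0.
    by rewrite lerDl.
  rewrite add0r (le_trans (ler_norm _))// mulrCA mulrC normrM mulrC.
  rewrite -[leRHS]mul1r ler_wpM2r//.
  by rewrite ler_norml sin_geN1 sin_le1.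
rewrite leNgt; apply/negP => m0.
(* At this T the upper bound of [FB] equals -1. *)
have T0 : 0 < (B + 1) / - trig_mean0 s by rewrite divr_gt0 ?oppr_gt0// ltr_wpDl.
have := le_trans (FT _ T0) (FB _ T0).
by rewrite invrN mulrN mulrN mulrCA divff ?lt_eqF// mulr1; lra.
Qed.

Definition trig f := exists s, f =1 trig_eval s.

Lemma trig_eval_mean0_le s s' :
  (forall t, trig_eval s t <= trig_eval s' t) -> trig_mean0 s <= trig_mean0 s'.
Proof.
move=> le; rewrite -subr_ge0.
pose s2 := s' ++ [seq (- p.1, p.2) | p <- s].
have -> : trig_mean0 s' - trig_mean0 s = trig_mean0 s2.
  by rewrite /trig_mean0 /s2 big_cat big_map /= sumrN.
apply: trig_mean0_ge0 => t.
have -> : trig_eval s2 t = trig_eval s' t - trig_eval s t.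
  rewrite /trig_eval /s2 big_cat big_map /= -sumrN; congr (_ + _).
  by apply: eq_bigr => p _; rewrite mulNr.
by rewrite subr_ge0.
Qed.

(** A choice among the representations of [f], with default 0 if there is none; [meanE] shows that
    the choice is immaterial. *)
Definition mean f : R :=
  xget 0 [set m | exists2 s, f =1 trig_eval s & m = trig_mean0 s]%classic.

(** Two representations of the same function bound each other pointwise, so positivity of the mean
    forces their constants to agree. *)
Lemma meanE f s : f =1 trig_eval s -> mean f = trig_mean0 s.
Proof.
move=> fs; rewrite /mean; case: xgetP => [m _ [s' fs' ->]|no].
  by apply/le_anti/andP; split; apply: trig_eval_mean0_le => t; rewrite -fs -fs'.
by have := no (trig_mean0 s); case; exists s.
Qed.

Lemma eq_mean f g : f =1 g -> mean f = mean g.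
Proof. by move/funext ->. Qed.

Lemma eq_trig f g : f =1 g -> trig f -> trig g.
Proof. by move/funext ->. Qed.

Lemma ler_mean f g : trig f -> trig g -> (forall t, f t <= g t) -> mean f <= mean g.
Proof.
move=> [s fs] [s' gs] le; rewrite (meanE fs) (meanE gs).
by apply: trig_eval_mean0_le => t; rewrite -fs -gs.
Qed.

Lemma trig_cos (x : R) : trig (fun t => cos (x * t)).
Proof. by exists [:: (1, x)] => t; rewrite /trig_eval big_seq1 mul1r. Qed.

Lemma mean_cos (x : R) : mean (fun t => cos (x * t)) = (x == 0)%:R.
Proof.
rewrite (@meanE _ [:: (1, x)]) => [|t]; last by rewrite /trig_eval big_seq1 mul1r.
by rewrite /trig_mean0 big_cons big_nil /= addr0; case: eqP.
Qed.

Lemma trig_cst (c : R) : trig (fun=> c).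
Proof. by exists [:: (c, 0)] => t; rewrite /trig_eval big_seq1 mul0r cos0 mulr1. Qed.

Lemma mean_cst (c : R) : mean (fun=> c) = c.
Proof.
rewrite (@meanE _ [:: (c, 0)]) => [|t]; last by rewrite /trig_eval big_seq1 mul0r cos0 mulr1.
by rewrite /trig_mean0 big_cons big_nil /= addr0 eqxx.
Qed.

Lemma trigD f g : trig f -> trig g -> trig (fun t => f t + g t).
Proof.
move=> [s fs] [s' gs]; exists (s ++ s') => t.
by rewrite /trig_eval big_cat /= fs gs.
Qed.

Lemma meanD f g : trig f -> trig g -> mean (fun t => f t + g t) = mean f + mean g.
Proof.
move=> [s fs] [s' gs]; rewrite (meanE fs) (meanE gs) (@meanE _ (s ++ s')) => [|t].
  by rewrite /trig_mean0 big_cat.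
by rewrite /trig_eval big_cat /= fs gs.
Qed.

Lemma trigM f g : trig f -> trig g -> trig (fun t => f t * g t).
Proof.
move=> [s fs] [s' gs].
(* Product-to-sum formula, applied to every pair of terms. *)
exists (flatten [seq flatten [seq [:: (p.1 * q.1 / 2, p.2 + q.2); (p.1 * q.1 / 2, p.2 - q.2)]
   | q <- s'] | p <- s]) => t.
rewrite fs gs /trig_eval mulr_suml big_flatten big_map /=; apply: eq_bigr => p _.
rewrite mulr_sumr big_flatten big_map /=; apply: eq_bigr => q _.
by rewrite big_cons big_seq1 /= !mulrDl mulNr cosB cosD; lra.
Qed.

Lemma trigZ (c : R) f : trig f -> trig (fun t => c * f t).
Proof. by move=> tf; apply: trigM => //; exact: trig_cst. Qed.

Lemma meanZ (c : R) f : trig f -> mean (fun t => c * f t) = c * mean f.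
Proof.
move=> [s fs]; rewrite (meanE fs) (@meanE _ [seq (c * p.1, p.2) | p <- s]) => [|t].
  by rewrite /trig_mean0 big_map mulr_sumr.
rewrite fs /trig_eval big_map mulr_sumr; apply: eq_bigr => p _.
by rewrite mulrA.
Qed.

Lemma trigX f k : trig f -> trig (fun t => f t ^+ k).
Proof.
move=> tf; elim: k => [|k IH]; first exact: (trig_cst 1).
by apply: (@eq_trig (fun t => f t * f t ^+ k)) => [t|]; [rewrite exprS|exact: trigM].
Qed.

Lemma trig_big (T : Type) (r : seq T) (P : pred T) (F : T -> R -> R) :
  (forall x, P x -> trig (F x)) -> trig (fun t => \sum_(x <- r | P x) F x t).
Proof.
move=> tF; elim: r => [|x r IH].
  by apply: (@eq_trig (fun=> 0)) => [t|]; [rewrite big_nil|exact: trig_cst].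
case Px: (P x).
  apply: (@eq_trig (fun t => F x t + \sum_(x <- r | P x) F x t)) => [t|].
    by rewrite big_cons Px.
  by apply: trigD => //; exact: tF.
by apply: eq_trig IH => t; rewrite big_cons Px.
Qed.

Lemma trig_prod (T : Type) (r : seq T) (P : pred T) (F : T -> R -> R) :
  (forall x, P x -> trig (F x)) -> trig (fun t => \prod_(x <- r | P x) F x t).
Proof.
move=> tF; elim: r => [|x r IH].
  by apply: (@eq_trig (fun=> 1)) => [t|]; [rewrite big_nil|exact: trig_cst].
case Px: (P x).
  apply: (@eq_trig (fun t => F x t * \prod_(x <- r | P x) F x t)) => [t|].
    by rewrite big_cons Px.
  by apply: trigM => //; exact: tF.
by apply: eq_trig IH => t; rewrite big_cons Px.
Qed.

Lemma trig_avg (T : finType) (F : T -> R -> R) :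
  (forall x, trig (F x)) -> trig (fun t => avg (fun x => F x t)).
Proof. by move=> tF; apply: trigM; [exact: trig_big|exact: trig_cst]. Qed.

Lemma mean_sum (T : Type) (r : seq T) (F : T -> R -> R) :
  (forall x, trig (F x)) ->
  mean (fun t => \sum_(x <- r) F x t) = \sum_(x <- r) mean (F x).
Proof.
move=> tF; elim: r => [|x r IH].
  by rewrite big_nil -[RHS](mean_cst 0); apply: eq_mean => t; rewrite big_nil.
rewrite big_cons -IH -meanD//; last exact: trig_big.
by apply: eq_mean => t; rewrite big_cons.
Qed.

Lemma mean_avg (T : finType) (F : T -> R -> R) :
  (forall x, trig (F x)) ->
  mean (fun t => avg (fun x => F x t)) = avg (fun x => mean (F x)).
Proof.
move=> tF; rewrite /avg -mean_sum// mulrC -meanZ; last exact: trig_big.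
by apply: eq_mean => t; rewrite mulrC.
Qed.

(* Nonnegative combinations of cosines: the characteristic functions of
   symmetric finite distributions, up to the total mass [f 0]. *)
Definition posdef f :=
  exists2 s, f =1 trig_eval s & forall p, p \in s -> 0 <= p.1.

Lemma eq_posdef f g : f =1 g -> posdef f -> posdef g.
Proof. by move/funext ->. Qed.

Lemma posdef_cst (c : R) : 0 <= c -> posdef (fun=> c).
Proof.
move=> c0; exists [:: (c, 0)] => [t|p]; last by rewrite inE => /eqP ->.
by rewrite /trig_eval big_seq1 mul0r cos0 mulr1.
Qed.

Lemma posdef_cos (x : R) : posdef (fun t => cos (x * t)).
Proof.
exists [:: (1, x)] => [t|p]; last by rewrite inE => /eqP ->.
by rewrite /trig_eval big_seq1 mul1r.
Qed.

Lemma posdefD f g : posdef f -> posdef g -> posdef (fun t => f t + g t).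
Proof.
move=> [s fs s0] [s' gs s'0]; exists (s ++ s') => [t|p].
  by rewrite /trig_eval big_cat /= fs gs.
by rewrite mem_cat => /orP[/s0|/s'0].
Qed.

Lemma posdefM f g : posdef f -> posdef g -> posdef (fun t => f t * g t).
Proof.
move=> [s fs s0] [s' gs s'0].
exists (flatten [seq flatten [seq [:: (p.1 * q.1 / 2, p.2 + q.2); (p.1 * q.1 / 2, p.2 - q.2)]
   | q <- s'] | p <- s]) => [t|u].
  rewrite fs gs /trig_eval mulr_suml big_flatten big_map /=; apply: eq_bigr => p _.
  rewrite mulr_sumr big_flatten big_map /=; apply: eq_bigr => q _.
  by rewrite big_cons big_seq1 /= !mulrDl mulNr cosB cosD; lra.
move=> /flattenP[_ /mapP[p /s0 p0 ->] /flattenP[_ /mapP[q /s'0 q0 ->]]].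
by rewrite !inE => /orP[] /eqP -> /=; rewrite !mulr_ge0.
Qed.

Lemma posdef_avg (T : finType) (F : T -> R -> R) :
  (forall x, posdef (F x)) -> posdef (fun t => avg (fun x => F x t)).
Proof.
move=> tF; apply: posdefM; last by apply: posdef_cst; rewrite invr_ge0 ler0n.
elim: (index_enum T) => [|x r IH].
  by apply: (@eq_posdef (fun=> 0)) => [t|]; [rewrite big_nil|exact: posdef_cst].
apply: (@eq_posdef (fun t => F x t + \sum_(x <- r) F x t)) => [t|].
  by rewrite big_cons.
exact: posdefD.
Qed.

Lemma posdefX f k : posdef f -> posdef (fun t => f t ^+ k).
Proof.
move=> tf; elim: k => [|k IH]; first exact: (@posdef_cst 1).
by apply: (@eq_posdef (fun t => f t * f t ^+ k)) => [t|]; [rewrite exprS|exact: posdefM].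
Qed.

(** [f] is a nonnegative combination of cosines of total mass [f 0], so it suffices to bound the
    mean against each single cosine. *)
Lemma mean_posdefM_le f g (B : R) : posdef f -> trig g ->
  (forall w, mean (fun t => cos (w * t) * g t) <= B) ->
  mean (fun t => f t * g t) <= f 0 * B.
Proof.
move=> [s fs s0] tg gB.
have tcg w : trig (fun t => cos (w * t) * g t) by apply: trigM => //; exact: trig_cos.
rewrite (@eq_mean _ (fun t => \sum_(p <- s) p.1 * (cos (p.2 * t) * g t))) => [|t].
  rewrite mean_sum => [|p]; last exact: trigZ.
  rewrite fs /trig_eval mulr_suml !big_seq; apply: ler_sum => p /s0 p0.
  by rewrite meanZ// mulr0 cos0 mulr1 ler_wpM2l.
by rewrite fs /trig_eval mulr_suml; apply: eq_bigr => p _; rewrite mulrA.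
Qed.

(** Fourier inversion at 0: the mean of the real part of the characteristic function is the
    probability of the value 0. *)
Lemma mean_avg_cos (T : finType) (X : T -> R) :
  mean (fun t => avg (fun w => cos (X w * t))) = avg (fun w => (X w == 0)%:R).
Proof.
rewrite mean_avg => [|w]; last exact: trig_cos.
by apply: eq_avg => w; exact: mean_cos.
Qed.

End TrigMean.

(** * Characteristic functions of independent sums *)

Section IndependentSums.
Variable R : realType.

(** The complex exponential of ix, which turns sums of independent terms into products. *)
Definition expi (x : R) : R[i] := Complex (cos x) (sin x).

Lemma expiD x y : expi (x + y) = expi x * expi y.
Proof. by rewrite /expi cosD sinD; congr Complex; rewrite addrC. Qed.

Lemma expi_sum (I : finType) (F : I -> R) : expi (\sum_i F i) = \prod_i expi (F i).
Proof. by apply: (big_morph expi expiD); rewrite /expi cos0 sin0. Qed.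

Lemma complex_sum (T : finType) (F G : T -> R) :
  \sum_w Complex (F w) (G w) = Complex (\sum_w F w) (\sum_w G w).
Proof.
elim: (index_enum T) => [|w r IH]; first by rewrite !big_nil.
by rewrite !big_cons IH.
Qed.

(* The sine averages vanish for symmetric variables. *)
Lemma avg_cos_sum (I T : finType) (X : I -> T -> R) (phi : R) :
  (forall i, \sum_w sin (X i w) = 0) ->
  avg (fun w : {ffun I -> T} => cos (\sum_i X i (w i) - phi)) =
  cos phi * \prod_i avg (fun w => cos (X i w)).
Proof.
move=> s0.
(* Distributivity factors the total sum over all coordinates; each factor is real because its sine
   sum vanishes. *)
have H : \sum_(w : {ffun I -> T}) expi (\sum_i X i (w i)) =
   Complex (\prod_i \sum_w cos (X i w)) 0.
  rewrite (eq_bigr (fun w : {ffun I -> T} => \prod_i expi (X i (w i)))); last first.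
    by move=> w _; exact: (expi_sum (fun i => X i (w i))).
  rewrite -(bigA_distr_bigA (fun i w => expi (X i w))) /=.
  have -> : Complex (\prod_i \sum_w cos (X i w)) 0 =
      \prod_i Complex (\sum_w cos (X i w)) 0.
    apply: (big_morph (fun x => Complex x 0)) => // x y.
    by rewrite /GRing.mul /= !mulr0 !mul0r subr0 addr0.
  by apply: eq_bigr => i _; rewrite /expi complex_sum s0.
move: H; rewrite /expi complex_sum => -[Hc Hs].
rewrite /avg big_split /= prodr_const exprVn card_ffun natrX mulrA; congr (_ / _).
under eq_bigr do rewrite cosB.
by rewrite big_split /= -!mulr_suml Hc Hs mul0r addr0 mulrC.
Qed.
End IndependentSums.

(** * Upper bounds for binomial coefficients *)

Section CentralBinomial.

Lemma bin_le_central n k : ('C(n, k) <= 'C(n, n./2))%N.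
Proof.
have hn : (n./2.*2 <= n)%N by rewrite -{2}(odd_double_half n) leq_addl.
have hn1 : (n <= n./2.*2.+1)%N.
  by rewrite -{1}(odd_double_half n) -[leqRHS]add1n leq_add2r; case: (odd n).
have up m j : ((j + m).*2 <= n)%N -> ('C(n, j) <= 'C(n, j + m))%N.
  elim: m => [|m IH] le; first by rewrite addn0.
  apply: leq_trans (IH _) _; first by lia.
  rewrite -(leq_pmul2l (ltn0Sn (j + m))) addnS mul_bin_left leq_mul2r; apply/orP; right.
  by lia.
have half j : (j <= n./2)%N -> ('C(n, j) <= 'C(n, n./2))%N.
  move=> le; have := up (n./2 - j)%N j; rewrite subnKC//; apply.
  exact: hn.
have [|lt] := leqP k n./2; first exact: half.
have [kn|kn] := leqP k n; last by rewrite bin_small.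
rewrite -bin_sub//; apply: half.
by lia.
Qed.

(** Induction on the recurrence [E] below, squared; the step reduces to (2m+1)(2m+3) <= 4(m+1)^2. *)
Lemma central_bin_even m : ('C(m.*2, m) ^ 2 * m.*2.+1 <= 16 ^ m)%N.
Proof.
elim: m => [//|m IH].
have E : (m.+1 * 'C(m.+1.*2, m.+1) = 2 * m.*2.+1 * 'C(m.*2, m))%N.
  have h1 := mul_bin_diag m.*2.+2 m.
  have h2 := mul_bin_down m.*2.+1 m.
  have e : (m.*2.+1 - m = m.+1)%N by lia.
  rewrite /= e in h1 h2; rewrite doubleS -h1 -[RHS]mulnA h2 -doubleS -mul2n.
  by rewrite mulnA.
have sq : (m.+1 ^ 2 * ('C(m.+1.*2, m.+1) ^ 2 * m.+1.*2.+1) <= m.+1 ^ 2 * 16 ^ m.+1)%N.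
  rewrite [X in (X <= _)%N]mulnA -expnMn E [(16 ^ m.+1)%N]expnS.
  apply: (@leq_trans (4 * (m.*2.+1 * m.*2.+3) * ('C(m.*2, m) ^ 2 * m.*2.+1)))%N; first by nia.
  apply: (leq_trans (leq_mul (leqnn _) IH)).
  rewrite [(m.+1 ^ 2 * _)%N]mulnA leq_mul2r; apply/orP; right; nia.
by move: sq; rewrite leq_pmul2l// expn_gt0.
Qed.

(** For odd n = 2m+1 the central coefficient is half of the one for 2m+2, which reduces to the even
    case. *)
Lemma central_bin_bound n k : ('C(n, k) ^ 2 * n.+1 <= 4 ^ n)%N.
Proof.
apply: (@leq_trans ('C(n, n./2) ^ 2 * n.+1)); first by rewrite leq_mul2r leq_exp2r// bin_le_central orbT.
have e16 m : (16 ^ m = 4 ^ m.*2)%N by rewrite -muln2 mulnC expnM.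
rewrite -{1 3 4}(odd_double_half n); set m := n./2; case: (odd n); last first.
  rewrite -[(_ + m.*2)%N]/(m.*2) -e16; exact: central_bin_even.
rewrite -[(_ + m.*2)%N]/(m.*2.+1).
have E : ('C(m.+1.*2, m.+1) = 2 * 'C(m.*2.+1, m))%N.
  have e : 'C(m.*2.+1, m.+1) = 'C(m.*2.+1, m).
    by rewrite -bin_sub; [congr 'C(_, _)|]; lia.
  by rewrite doubleS binS e addnn mul2n.
have := central_bin_even m.+1; rewrite E e16 doubleS expnMn (expnS 4 m.*2.+1).
set x := ('C(_, _) ^ 2)%N; set y := (4 ^ _)%N; nia.
Qed.

End CentralBinomial.

(** * The LYM inequality and Sperner's bound *)

Section Antichains.
Variables (R : realType) (T : finType).
Implicit Types (A : {set {set T}}) (S U : {set T}).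

Definition antichain A := forall S U, S \in A -> U \in A -> ~~ (S \proper U).

(** The expected number of members of [A] on a uniformly random maximal chain of subsets of [S]. *)
Definition lym A S : R := \sum_(U in A | U \subset S) 'C(#|S|, #|U|)%:R^-1.

(** Induction on the size of [S]. If [S] belongs to the antichain it is the only contribution;
    otherwise the LYM sum is the average of those of the sets [S :\ i], which corresponds to
    removing the top of the random chain. *)
Lemma lym_le1 A S : antichain A -> lym A S <= 1.
Proof.
move=> anti; have [m] := ubnP #|S|; elim: m S => // m IH S /ltnSE-Sm.
case SA: (S \in A).
  rewrite /lym (bigD1 S) ?SA ?subxx//= binn invr1 big1 ?addr0// => U.
  case/andP => /andP[UA US] UnS; have := anti U S UA SA.
  by rewrite finset.properEneq UnS US.
have [S0|Spos] := posnP #|S|.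
  rewrite /lym big1 ?ler01// => U /andP[UA US].
  move: S0 US => /eqP; rewrite cards_eq0 => /eqP S0; rewrite S0 finset.subset0 => /eqP U0.
  by rewrite U0 -S0 SA in UA.
(* Each [U] lies in [S :\ i] for exactly |S| - |U| indices i, and (|S| - |U|) C(|S|, |U|) = |S|
   C(|S| - 1, |U|). *)
have -> : lym A S = #|S|%:R^-1 * \sum_(i in S) lym A (S :\ i).
  rewrite /lym mulr_sumr.
  transitivity (\sum_(U in A | U \subset S) \sum_(i in S :\: U)
      (#|S|%:R^-1 * 'C(#|S|.-1, #|U|)%:R^-1) : R).
    apply: eq_bigr => U /andP[UA US]; rewrite sumr_const.
    have UnS : U != S by apply: contraFneq SA => <-.
    have ltUS : (#|U| < #|S|)%N by apply: proper_card; rewrite finset.properEneq UnS.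
    have cd : #|S :\: U| = (#|S| - #|U|)%N by rewrite cardsD (finset.setIidPr US).
    rewrite cd -[RHS]mulr_natr.
    have := mul_bin_down #|S| #|U| => /(congr1 (fun x => x%:R : R)).
    rewrite !natrM => E.
    have n1 : (#|S|%:R : R) != 0 by rewrite pnatr_eq0 -lt0n.
    have n2 : ('C(#|S|.-1, #|U|)%:R : R) != 0 by rewrite pnatr_eq0 -lt0n bin_gt0; lia.
    have n3 : ('C(#|S|, #|U|)%:R : R) != 0 by rewrite pnatr_eq0 -lt0n bin_gt0; lia.
    rewrite -invfM mulrC; apply: (mulIf n3); rewrite mulVf//.
    apply: (mulIf (mulf_neq0 n1 n2)); rewrite mul1r E; field.
    by rewrite n3 pnatr_eq0 subn_eq0 -ltnNge.
  under [RHS]eq_bigr do rewrite mulr_sumr.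
  rewrite (exchange_big_dep (mem S)) /=; last first.
    by move=> U i /andP[UA US]; rewrite inE => /andP[].
  apply: eq_bigr => i iS.
  have cS : #|S :\ i| = #|S|.-1 by rewrite (cardsD1 i S) iS.
  rewrite cS; apply: eq_bigl => U; rewrite inE iS andbT finset.subsetD1.
  by rewrite -andbA.
rewrite mulrC ler_pdivrMr ?ltr0n// mul1r.
apply: (@le_trans _ _ (\sum_(i in S) 1)); last by rewrite sumr_const.
apply: ler_sum => i iS; apply: IH.
by apply: leq_trans Sm; rewrite [X in (_ < X)%N](cardsD1 i S) iS.
Qed.

(** LYM, with every binomial coefficient replaced by its upper bound [c]. *)
Lemma antichain_card A S : antichain A -> (forall U, U \in A -> U \subset S) ->
  #|A|%:R <= 2 ^+ #|S| / Num.sqrt #|S|.+1%:R :> R.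
Proof.
move=> anti sub; have := lym_le1 S anti.
set c := 2 ^+ #|S| / _.
have s0 : 0 < Num.sqrt #|S|.+1%:R :> R by rewrite sqrtr_gt0 ltr0n.
have c0 : 0 < c by rewrite divr_gt0// exprn_gt0.
have binc (k : nat) : 'C(#|S|, k)%:R <= c.
  rewrite /c ler_pdivlMr// -(@ler_pXn2r _ 2) ?nnegrE ?mulr_ge0 ?exprn_ge0 ?ler0n ?(ltW s0)//.
  rewrite exprMn sqr_sqrtr ?ler0n// -exprM mulnC exprM.
  have -> : (2 ^+ 2) ^+ #|S| = (4 ^ #|S|)%:R :> R by rewrite natrX -natrX.
  rewrite -natrX -natrM.
  rewrite ler_nat.
  exact: central_bin_bound.
move=> H.
have : #|A|%:R * c^-1 <= 1.
  apply: le_trans H; rewrite /lym (eq_bigl (mem A)); last first.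
    by move=> U /=; case UA: (U \in A) => //=; exact: sub.
  rewrite -sum1_card natr_sum mulr_suml; apply: ler_sum => U UA.
  rewrite mul1r lef_pV2 ?posrE// ltr0n bin_gt0 subset_leq_card//; exact: sub.
by rewrite ler_pdivrMr// mul1r.
Qed.

End Antichains.

(** * The Littlewood-Offord bound for random signs *)

Section SignedSums.
Variable R : realType.

(** Conditioning on the part [D] of the random set outside [O] leaves a uniform subset of [O]. *)
Lemma avg_setI_le (T : finType) (O : {set T}) (P : pred {set T}) (c : R) : 0 <= c ->
  (forall D : {set T}, D \subset ~: O ->
     #|[set S : {set T} | (S \subset O) && P (S :|: D)]|%:R <= c * 2 ^+ #|O|) ->
  avg (fun S : {set T} => (P S)%:R) <= c.
Proof.
move=> c0 H.
have cs : #|{: {set T}}| = (2 ^ #|T|)%N.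
  by rewrite -[LHS]cardsT -powersetT card_powerset cardsT.
rewrite avg_indic cs ler_pdivrMr ?ltr0n ?expn_gt0//.
have -> : #|[pred S : {set T} | P S]| =
  (\sum_(D in powerset (~: O)) #|[set S : {set T} | (S \subset O) && P (S :|: D)]|)%N.
  rewrite -sum1_card (partition_big (fun S : {set T} => S :\: O) (fun D => D \in powerset (~: O))) /=; last first.
    by move=> S _; rewrite inE finset.setDE finset.subsetIr.
  apply: eq_bigr => D; rewrite inE => DO; rewrite -sum1_card.
  have dis (S : {set T}) : S \subset O -> (S :|: D) :\: O = D /\ (S :|: D) :&: O = S.
    move=> SO; split; apply/setP => x; rewrite !inE;
    have := fintype.subsetP SO x; have := fintype.subsetP DO x; rewrite !inE;
    case: (x \in S) => /=; case: (x \in D) => /=; case: (x \in O) => //= h1 h2;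
    by [have := h1 isT|have := h2 isT].
  rewrite (reindex_onto (fun S : {set T} => S :|: D) (fun S => S :&: O)) /=; last first.
    by move=> S /andP[_ /eqP <-]; exact: finset.setID.
  apply: eq_bigl => S; rewrite !inE.
  apply/idP/idP => [/andP[/andP[PS _] /eqP e]|/andP[SO PS]].
    by rewrite PS andbT -e finset.subsetIr.
  by have [-> ->] := dis S SO; rewrite PS !eqxx.
rewrite natr_sum; apply: (@le_trans _ _ (\sum_(D in powerset (~: O)) c * 2 ^+ #|O|)).
  by apply: ler_sum => D; rewrite inE => /H.
rewrite sumr_const card_powerset -[leLHS]mulr_natr -mulrA; apply: ler_wpM2l => //.
by rewrite natrX -exprD cardsC natrX.
Qed.

(* Flipping a sign upwards inside [O] raises the sum by at least [2 y0], so a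
   window of length less than [2 y0] meets each chain at most once. *)
Lemma signed_sum_window (T : finType) (y : T -> R) (y0 : R) (W : pred R) : 0 < y0 ->
  (forall u v, W u -> W v -> v - u < 2 * y0) ->
  avg (fun S : {set T} => (W (\sum_i (if i \in S then - y i else y i)))%:R : R) <=
  (Num.sqrt #|[set i | y0 <= `|y i|]|.+1%:R)^-1.
Proof.
move=> y0p Wd; set O := [set i | _].
pose V (S : {set T}) := \sum_i (if i \in S then - y i else y i).
apply: (@avg_setI_le _ O (fun S => W (V S))); first by rewrite invr_ge0 sqrtr_ge0.
move=> D DO.
pose N := [set i in O | 0 < y i].
(* [sd S] is the set of indices of [O] whose signed term is [|y i|] rather than [- |y i|], so for a
   fixed part [D] outside [O] the sum is monotone in [sd S]. On subsets of [O] the map is an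
   involution, hence injective. *)
pose sd (S : {set T}) := [set i in O | (i \in S) (+) (i \in N)].
set B := [set S | _].
have sdK (S : {set T}) : S \subset O -> sd (sd S) = S.
  move=> SO; apply/setP => i; rewrite !inE.
  have := fintype.subsetP SO i.
  case: (i \in S); rewrite ?inE; case: (y0 <= `|y i|) => //=; case: (0 < y i) => //= h.
  - by have := h isT.
  - by have := h isT.
have inj : {in B &, injective sd}.
  move=> S S'; rewrite !inE => /andP[SO _] /andP[SO' _] e.
  by rewrite -(sdK S)// e sdK.
rewrite -(card_in_imset inj).
have -> : (Num.sqrt #|O|.+1%:R)^-1 * 2 ^+ #|O| = 2 ^+ #|O| / Num.sqrt #|O|.+1%:R :> R.
  by rewrite mulrC.
apply: antichain_card; last first.
  by move=> U /imsetP[S _ ->]; apply/fintype.subsetP => i; rewrite inE => /andP[].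
move=> U U' /imsetP[S + ->] /imsetP[S' + ->].
rewrite !inE => /andP[SO WS] /andP[SO' WS']; apply/negP => pr.
have [sub [i iU' iU]] := properP pr.
have iO : i \in O by move: iU'; rewrite inE => /andP[].
have Si (j : T) : j \notin O -> (j \in S :|: D) = (j \in S' :|: D).
  move=> jO; rewrite !inE; have := contra (fintype.subsetP SO j) jO.
  by have := contra (fintype.subsetP SO' j) jO; move=> /negbTE -> /negbTE ->.
have Dj (j : T) : j \in O -> j \notin D.
  by move=> jO; apply: contraL jO => /(fintype.subsetP DO); rewrite inE.
pose v (Z : {set T}) (j : T) := if j \in Z then - y j else y j.
have vE (Z : {set T}) (j : T) : j \in O -> v (Z :|: D) j = if j \in sd Z then `|y j| else - `|y j|.
  move=> jO; rewrite /v inE (negbTE (Dj j jO)) orbF inE jO inE jO /=.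
  case: (ltrP 0 (y j)) => yj; case: (j \in Z) => /=;
  by rewrite ?(gtr0_norm yj) ?(ler0_norm yj) ?opprK.
have le (j : T) : v (S :|: D) j <= v (S' :|: D) j.
  case jO: (j \in O); last by rewrite /v Si ?jO.
  rewrite !vE//; case jS: (j \in sd S); first by rewrite (fintype.subsetP sub j jS).
  by case: ifP => _ //; rewrite (le_trans _ (normr_ge0 _))// oppr_le0.
have := Wd _ _ WS WS'; rewrite /V -sumrB (bigD1 i)//=.
apply/negP; rewrite -leNgt.
have -> : 2 * y0 = 2 * y0 + 0 by rewrite addr0.
apply: lerD; last by apply: sumr_ge0 => j _; rewrite subr_ge0; exact: le.
have := vE S i iO; have := vE S' i iO; rewrite /v iU' (negbTE iU) => -> ->.
by move: iO; rewrite inE => ?; lra.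
Qed.

End SignedSums.

(** * Splitting off the first coordinate of a random function *)

Section FfunCons.
Variables (R : realType) (T : finType).

Definition fcons q (w : T) (v : {ffun 'I_q -> T}) : {ffun 'I_q.+1 -> T} :=
  [ffun i => if unlift ord0 i is Some j then v j else w].

Lemma fcons0 q w (v : {ffun 'I_q -> T}) : fcons w v ord0 = w.
Proof. by rewrite ffunE unlift_none. Qed.

Lemma fconsS q w (v : {ffun 'I_q -> T}) j : fcons w v (lift ord0 j) = v j.
Proof. by rewrite ffunE liftK. Qed.

Lemma sum_fcons (V : nmodType) q w (v : {ffun 'I_q -> T}) (F : T -> V) :
  \sum_i F (fcons w v i) = F w + \sum_i F (v i).
Proof.
by rewrite big_ord_recl fcons0; congr (_ + _); apply: eq_bigr => i _; rewrite fconsS.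
Qed.

Lemma avg_fcons q (F : {ffun 'I_q.+1 -> T} -> R) :
  avg F = avg (fun w => avg (fun v => F (fcons w v))).
Proof.
rewrite -(avg_pair (fun p => F (fcons p.1 p.2))); symmetry; apply: avg_reindex.
exists (fun u : {ffun 'I_q.+1 -> T} => (u ord0, [ffun j => u (lift ord0 j)])).
  by case=> w v /=; rewrite fcons0; congr pair; apply/ffunP => j; rewrite ffunE fconsS.
move=> u; apply/ffunP => i /=; rewrite ffunE.
by case: unliftP => [j|] ->; rewrite ?ffunE.
Qed.

End FfunCons.

(** * Sums of independent copies of a symmetric variable *)

Section IidAnticoncentration.
Variables (R : realType) (T : finType) (Y : T -> R) (iota : T -> T) (rho : R).
Hypothesis iotaK : involutive iota.
Hypothesis iotaY : forall w, Y (iota w) = - Y w.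
Hypothesis nz : 4^-1 <= avg (fun w => (Y w != 0)%:R : R).
Hypothesis fib : forall x, avg (fun w => (Y w == x)%:R : R) <= rho.

(** An upper quartile of |Y|: take the largest nonzero attained value of |Y| that is still reached
    or exceeded with probability at least 1/4. If it were strictly exceeded with probability above
    1/4, the next attained value would qualify too. *)
Lemma abs_quantile : exists y0 : R, [/\ 0 < y0,
  4^-1 <= avg (fun w => (y0 <= `|Y w|)%R%:R : R) &
  avg (fun w => (y0 < `|Y w|)%R%:R : R) <= 4^-1].
Proof.
have [w0 w0n] : exists w, Y w != 0.
  apply/existsP; apply: contraT => /existsPn H; move: nz.
  rewrite (@eq_avg _ _ _ (fun=> 0)) => [|w]; last by rewrite (negbTE (H w)).
  have : avg (fun _ : T => 0 : R) <= 0 by apply: avg_le.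
  by move=> h1 h2; have := le_trans h2 h1; rewrite invr_le0 (lern0 _ 4).
pose good w := (Y w != 0) && (4^-1 <= avg (fun v => (`|Y w| <= `|Y v|)%R%:R : R)).
have [w1 w1g] : exists w, good w.
  case: (@arg_minP _ _ _ w0 (fun w => Y w != 0) (fun w => `|Y w|) w0n) => w1 w1n min.
  exists w1; rewrite /good w1n (le_trans nz)//; apply: ler_avg => v.
  by case: eqP => //= /eqP /min ->.
case: (@arg_maxP _ _ _ w1 good (fun w => `|Y w|) w1g) => w2 /andP[w2n w2g] max.
exists `|Y w2|; split => //; first by rewrite normr_gt0.
rewrite leNgt; apply/negP => gt.
have [w3 w3n] : exists w, `|Y w2| < `|Y w|.
  apply/existsP; apply: contraT => /existsPn H; move: gt.
  rewrite (@eq_avg _ _ _ (fun=> 0)) => [|w]; last by rewrite (negbTE (H w)).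
  have : avg (fun _ : T => 0 : R) <= 0 by apply: avg_le.
  by move=> h1 h2; have := lt_le_trans h2 h1; rewrite invr_lt0 (ltrn0 _ 4).
case: (@arg_minP _ _ _ w3 (fun w => `|Y w2| < `|Y w|) (fun w => `|Y w|) w3n) => w4 w4n min.
have : good w4.
  apply/andP; split; first by rewrite -normr_gt0 (le_lt_trans _ w4n).
  apply: (le_trans (ltW gt)); apply: ler_avg => v.
  by case: (ltrP `|Y w2| `|Y v|) => //= /min ->.
by move/max => /=; rewrite leNgt w4n.
Qed.

Section SmallBall.
Variable y0 : R.
Hypothesis y0_gt0 : 0 < y0.
Hypothesis y0_out : 4^-1 <= avg (fun w => (y0 <= `|Y w|)%R%:R : R).

Let cnt q (v : {ffun 'I_q -> T}) : nat := (\sum_i (y0 <= `|Y (v i)|)%R)%N.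

(** Among q + 1 copies, the shares [copy i is large] / (number of large copies) add up to at most 1.
    By exchangeability they have equal means, and the mean of the first is P(|Y| >= y0) times the
    average in question. *)
Lemma avg_inv_count q :
  avg (fun v : {ffun 'I_q -> T} => (cnt v).+1%:R^-1 : R) <= 4 / q.+1%:R.
Proof.
pose Z (i : 'I_q.+1) (v : {ffun 'I_q.+1 -> T}) : R :=
  (y0 <= `|Y (v i)|)%R%:R / (cnt v)%:R.
have Zi i : avg (Z i) = avg (Z ord0).
  pose h (v : {ffun 'I_q.+1 -> T}) := [ffun j => v (tperm ord0 i j)].
  have hK : involutive h by move=> v; apply/ffunP => j; rewrite !ffunE tpermK.
  rewrite -[RHS](avg_reindex _ (inv_bij hK)); apply: eq_avg => v.
  rewrite /Z ffunE tpermL /cnt; congr (_ / _%:R).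
  rewrite (reindex_inj (@perm_inj _ (tperm ord0 i))) /=.
  by apply: eq_bigr => j _; rewrite ffunE.
have le1 : avg (fun v => \sum_i Z i v) <= 1.
  apply: avg_le => // v; rewrite /Z -mulr_suml -natr_sum -/(cnt v).
  have [->|c0] := posnP (cnt v); first by rewrite mul0r ler01.
  by rewrite divff// pnatr_eq0 -lt0n.
have sumE : avg (fun v => \sum_i Z i v) = q.+1%:R * avg (Z ord0).
  transitivity (\sum_(i < q.+1) avg (Z ord0)).
    by rewrite {1}/avg exchange_big /= mulr_suml; apply: eq_bigr => i _; exact: Zi.
  by rewrite sumr_const card_ord mulr_natl.
have Z0 : avg (Z ord0) = avg (fun w => (y0 <= `|Y w|)%R%:R : R) *
    avg (fun v : {ffun 'I_q -> T} => (cnt v).+1%:R^-1 : R).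
  rewrite avg_fcons -avgZr; apply: eq_avg => w; rewrite -avgZ; apply: eq_avg => v.
  rewrite /Z fcons0 /cnt.
  case: (lerP y0 `|Y w|) => yw; last by rewrite !mul0r.
  by congr (_ / _%:R); rewrite (sum_fcons w v (fun w => nat_of_bool (y0 <= `|Y w|)%R)) yw.
move: le1 y0_out; rewrite sumE Z0.
set p := avg (fun w => _%:R); set E := avg _ => le1 pge.
have E0 : 0 <= E by apply: avg_ge0 => v; rewrite invr_ge0.
rewrite ler_pdivlMr//.
have : q.+1%:R * (4^-1 * E) <= q.+1%:R * (p * E).
  by apply: ler_wpM2l; [exact: ler0n|exact: ler_wpM2r].
by move: le1; lra.
Qed.

(** By symmetry of Y, applying [iota] on a random set of coordinates preserves the law, so for fixed
    values the Littlewood-Offord bound applies with [cnt v] large steps; then average over the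
    values. *)
Lemma small_ball q (z : R) :
  avg (fun v : {ffun 'I_q -> T} => (`|\sum_i Y (v i) - z| <= y0)%R%:R : R) <=
  4 / Num.sqrt q.+1%:R.
Proof.
pose flip (S : {set 'I_q}) (v : {ffun 'I_q -> T}) : {ffun 'I_q -> T} :=
  [ffun i => if i \in S then iota (v i) else v i].
have flipK S : involutive (flip S).
  by move=> v; apply/ffunP => i; rewrite !ffunE; case: (i \in S); rewrite ?iotaK.
set F := fun v : {ffun 'I_q -> T} => _.
have -> : avg F = avg (fun v => avg (fun S => F (flip S v))).
  rewrite avg_exchange.
  transitivity (avg (fun _ : {set 'I_q} => avg F)).
    by rewrite avg_cst// (cardD1 finset.set0).
  by apply: eq_avg => S; rewrite (avg_reindex _ (inv_bij (flipK S))).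
apply: (@le_trans _ _ (avg (fun v : {ffun 'I_q -> T} => 2 * (Num.sqrt (cnt v).+1%:R)^-1))).
  apply: ler_avg => v.
  have sb W := @signed_sum_window R _ (fun i => Y (v i)) y0 W y0_gt0.
  have -> : cnt v = #|[set i | y0 <= `|Y (v i)|]|.
    by rewrite /cnt -sum1_card [RHS]big_mkcond; apply: eq_bigr => i _; rewrite inE; case: ifP.
  pose W1 (u : R) := (z - y0 <= u) && (u < z).
  pose W2 (u : R) := (z <= u) && (u <= z + y0).
  have h1 u u' : W1 u -> W1 u' -> u' - u < 2 * y0.
    by rewrite /W1 => /andP[? ?] /andP[? ?]; move: y0_gt0; lra.
  have h2 u u' : W2 u -> W2 u' -> u' - u < 2 * y0.
    by rewrite /W2 => /andP[? ?] /andP[? ?]; move: y0_gt0; lra.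
  rewrite mulr2n mulrDl mul1r; apply: (le_trans _ (lerD (sb W1 h1) (sb W2 h2))).
  rewrite -avgD; apply: ler_avg => S; rewrite /F.
  have -> : \sum_i Y (flip S v i) = \sum_i (if i \in S then - Y (v i) else Y (v i)).
    by apply: eq_bigr => i _; rewrite ffunE; case: ifP.
  set u := \sum_i _; rewrite /W1 /W2 -natrD ler_nat ler_norml.
  case: (boolP (_ <= _ <= _)) => [/andP[h3 h4]|_] //.
  case: (ltrP u z) => uz; last by rewrite (_ : u <= z + y0) ?addn1//; lra.
  by rewrite (_ : z - y0 <= u)//; lra.
rewrite avgZ.
have -> : 4 / Num.sqrt q.+1%:R = 2 * Num.sqrt (4 / q.+1%:R) :> R.
  rewrite sqrtrM// sqrtrV//.
  have -> : 4 = 2 ^+ 2 :> R by rewrite -natrX.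
  by rewrite sqrtr_sqr ger0_norm//; ring.
apply: ler_wpM2l => //.
set E := avg _.
have E0 : 0 <= E by apply: avg_ge0 => v; rewrite invr_ge0 sqrtr_ge0.
rewrite -(ger0_norm E0) -sqrtr_sqr; apply: ler_wsqrtr.
apply: (le_trans (sqr_avg_le _)); apply: le_trans (avg_inv_count q).
by apply: ler_avg => v; rewrite exprVn sqr_sqrtr// ler0n.
Qed.
End SmallBall.

(** Induction on q, splitting on the first copy. If it is at most y0 in absolute value, the rest
    falls within y0 of x, and the first copy then hits a prescribed value with probability at most
    [rho]. Otherwise, with probability at most 1/4, the induction hypothesis applies to the rest. *)
Lemma iid_anticoncentration q (x : R) :
  avg (fun v : {ffun 'I_q.+1 -> T} => (\sum_i Y (v i) == x)%:R : R) <=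
  8 * rho / Num.sqrt q.+1%:R.
Proof.
have [y0 [y0p yout ymid]] := abs_quantile.
have rho0 : 0 <= rho by apply: le_trans (fib 0); apply: avg_ge0 => w; rewrite ler0n.
elim: q x => [|q IH] x.
  rewrite avg_fcons sqrtr1 divr1.
  apply: (@le_trans _ _ rho); last by lra.
  apply: le_trans (fib x); apply: ler_avg => w; apply: avg_le; rewrite ?ler0n// => v.
  by rewrite sum_fcons big_ord0 addr0.
rewrite avg_fcons.
set s := Num.sqrt q.+2%:R; set s' := Num.sqrt q.+1%:R in IH.
have s0 : 0 < s by rewrite sqrtr_gt0.
have s'0 : 0 < s' by rewrite sqrtr_gt0.
(* The recursion closes because s <= (3/2) s', so that 4/s + 2/s' <= 7/s. *)
apply: (@le_trans _ _ (rho * (4 / s) + 4^-1 * (8 * rho / s'))); last first.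
  have ss : s <= 3 / 2 * s'.
    rewrite -(@ler_pXn2r _ 2) ?nnegrE ?mulr_ge0 ?(ltW s0) ?(ltW s'0)//.
    rewrite exprMn !sqr_sqrtr//.
    have -> : q.+2%:R = q.+1%:R + 1 :> R by rewrite -natr1.
    have : 1 <= q.+1%:R :> R by rewrite ler1n.
    by lra.
  have i1 : s'^-1 <= 3 / 2 * s^-1.
    by rewrite -[s'^-1]mul1r ler_pdivrMr// mulrAC ler_pdivlMr// mul1r.
  have AB : rho * s'^-1 <= rho * (3 / 2 * s^-1) by apply: ler_wpM2l.
  have A0 : 0 <= rho * s^-1 by rewrite mulr_ge0// invr_ge0 ltW.
  move: AB; have -> : rho * (3 / 2 * s^-1) = 3 / 2 * (rho * s^-1) by ring.
  have -> : rho * (4 / s) = 4 * (rho * s^-1) by ring.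
  have -> : 4^-1 * (8 * rho / s') = 2 * (rho * s'^-1).
    by move: s'^-1 => v; field.
  have -> : 8 * rho / s = 8 * (rho * s^-1) by rewrite mulrA.
  by move: A0; set A := rho * s^-1; set B := rho * s'^-1; lra.
apply: (@le_trans _ _ (avg (fun w => avg (fun v : {ffun 'I_q.+1 -> T} =>
    (`|\sum_i Y (v i) - x| <= y0)%R%:R * (Y w == x - \sum_i Y (v i))%:R)) +
  avg (fun w => (y0 < `|Y w|)%R%:R *
    avg (fun v : {ffun 'I_q.+1 -> T} => (\sum_i Y (v i) == x - Y w)%:R)))).
  rewrite -avgD; apply: ler_avg => w; rewrite -avgZ -avgD; apply: ler_avg => v.
  rewrite sum_fcons; set u := \sum_i _.
  case: eqP => [e|_]; last by rewrite addr_ge0// mulr_ge0// ler0n.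
  have ux : u = x - Y w by rewrite -e [Y w + u]addrC addrK.
  rewrite ux subKr !eqxx !mulr1 (_ : x - Y w - x = - Y w) ?normrN; last by ring.
  by case: lerP => _; rewrite ?addr0 ?add0r// lerDl ler0n.
apply: lerD.
  rewrite avg_exchange.
  apply: (@le_trans _ _ (avg (fun v : {ffun 'I_q.+1 -> T} =>
      (`|\sum_i Y (v i) - x| <= y0)%R%:R * rho))).
    by apply: ler_avg => v; rewrite avgZ; apply: ler_wpM2l; rewrite ?ler0n.
  rewrite avgZr mulrC; apply: ler_wpM2l => //; exact: small_ball.
apply: (@le_trans _ _ (avg (fun w => (y0 < `|Y w|)%R%:R * (8 * rho / s')))).
  by apply: ler_avg => w; apply: ler_wpM2l; rewrite ?ler0n.
by rewrite avgZr; apply: ler_wpM2r => //; rewrite !mulr_ge0// invr_ge0 ltW.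
Qed.

End IidAnticoncentration.

(** * Comparing Rademacher sums with sums of lazy copies *)

Section RademacherSums.
Variable R : realType.

Lemma sum_sin_symmetric (T : finType) (X : T -> R) (iota : T -> T) :
  involutive iota -> (forall w, X (iota w) = - X w) -> \sum_w sin (X w) = 0.
Proof.
move=> iotaK iotaX; set s := \sum_w _.
have : s = - s.
  rewrite /s [LHS](reindex_inj (inv_inj iotaK)) -sumrN.
  by apply: eq_bigr => w _; rewrite iotaX sinN.
by move=> e; lra.
Qed.

Lemma prod_le_avg_exp (T : finType) (E : T -> R) : (forall x, 0 <= E x) ->
  \prod_x E x <= avg E ^+ #|T|.
Proof.
move=> E0; have := @leif_AGM R T predT E (fun x _ => E0 x).
by move=> /leifP; case: ifP => _ => [/eqP ->|/ltW].
Qed.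

Lemma prod_le_avg (T : finType) (E : T -> R) : (0 < #|T|)%N -> (forall x, 0 <= E x) ->
  \prod_x E x <= avg (fun x => E x ^+ #|T|).
Proof.
move=> T0 E0; have := @prod_le_avg_exp T (fun x => E x ^+ #|T|) (fun x => exprn_ge0 _ (E0 x)).
rewrite prodrXl ler_pXn2r// nnegrE; first exact: prodr_ge0.
by apply: avg_ge0 => x; rewrite exprn_ge0.
Qed.

(** With c = |cos x| this is (c - 1)^2 >= 0. It replaces a cosine by a nonnegative characteristic
    function of a lazy step. *)
Lemma abs_cos_le (x : R) : `|cos x| <= (3 + cos (2 * x)) / 4.
Proof.
have -> : cos (2 * x) = 2 * `|cos x| ^+ 2 - 1.
  by rewrite mulr_natl cos_mulr2n real_normK ?num_real// mulr_natl.
have := sqr_ge0 (`|cos x| - 1).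
rewrite sqrrB1; lra.
Qed.

Variables (h : nat) (L : finType) (d : 'I_h * L -> R).
Hypotheses (h0 : (0 < h)%N) (L0 : (0 < #|L|)%N).

(** The sample space of Y: in every group, an element of [L] and the randomness of a lazy sign. *)
Definition choice_type : finType := {ffun 'I_h -> L * ('I_4 * bool)}.

(* For a uniform argument the values [1] and [-1] have probability 1/8 each, so
   that [(3 + cos x) / 4] is the average of [cos (lazy_sign u * x)]. *)
Definition lazy_sign (u : 'I_4 * bool) : R :=
  if u.1 == ord0 then (if u.2 then - 1 else 1) else 0.

(** The factor 2 is the doubled angle of [abs_cos_le]. *)
Definition lazy_step (j : 'I_h) (w : L * ('I_4 * bool)) : R :=
  2 * d (j, w.1) * lazy_sign w.2.

Definition lazy_sum (w : choice_type) : R := \sum_j lazy_step j (w j).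

Definition choice_flip (w : choice_type) : choice_type :=
  [ffun j => ((w j).1, ((w j).2.1, ~~ (w j).2.2))].

Lemma choice_flipK : involutive choice_flip.
Proof.
move=> w; apply/ffunP => j; rewrite !ffunE /= negbK.
by case: (w j) => [l [r e]].
Qed.

Lemma lazy_signN r e : lazy_sign (r, ~~ e) = - lazy_sign (r, e).
Proof. by rewrite /lazy_sign /=; case: (r == ord0); case: e => //=; rewrite ?opprK ?oppr0. Qed.

Lemma lazy_sum_flip w : lazy_sum (choice_flip w) = - lazy_sum w.
Proof.
rewrite /lazy_sum -sumrN; apply: eq_bigr => j _; rewrite /lazy_step ffunE /=.
by case: (w j) => [l [r e]] /=; rewrite lazy_signN mulrN.
Qed.

Lemma avg_lazy_sign (F : R -> R) : F (-1) = F 1 ->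
  avg (fun u => F (lazy_sign u)) = (3 * F 0 + F 1) / 4.
Proof.
move=> FN; rewrite avg_pair /lazy_sign /=.
rewrite (@eq_avg _ _ _ (fun r : 'I_4 => if r == ord0 then F 1 else F 0)) => [|r].
  rewrite /avg !big_ord_recl big_ord0 /= card_ord; lra.
by rewrite avg_bool; case: (r == ord0); rewrite ?FN; lra.
Qed.

Lemma sum_sin_lazy_step j (t : R) : \sum_w sin (lazy_step j w * t) = 0.
Proof.
apply: (@sum_sin_symmetric _ _ (fun w => (w.1, (w.2.1, ~~ w.2.2)))).
  by move=> [l [r e]] /=; rewrite negbK.
by move=> [l [r e]] /=; rewrite /lazy_step lazy_signN mulrN mulNr.
Qed.

Definition lazy_factor (j : 'I_h) (t : R) : R :=
  avg (fun l => (3 + cos (2 * (d (j, l) * t))) / 4).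

Lemma avg_cos_lazy_step j (t : R) :
  avg (fun w => cos (lazy_step j w * t)) = lazy_factor j t.
Proof.
rewrite avg_pair; apply: eq_avg => l.
rewrite (@eq_avg _ _ _ (fun u => cos (2 * (d (j, l) * t) * lazy_sign u))) => [|u].
  rewrite (@avg_lazy_sign (fun s => cos (2 * (d (j, l) * t) * s))).
    by rewrite mulr0 cos0 !mulr1.
  by rewrite mulrN cosN.
by congr cos; rewrite /lazy_step /=; ring.
Qed.

Lemma cos_avg_lazy_sum (t phi : R) :
  avg (fun w => cos (lazy_sum w * t - phi)) = cos phi * \prod_j lazy_factor j t.
Proof.
rewrite -(eq_bigr _ (fun j _ => avg_cos_lazy_step j t)).
rewrite -(@avg_cos_sum R _ _ (fun j w => lazy_step j w * t)).
  by apply: eq_avg => w; rewrite /lazy_sum mulr_suml.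
by move=> j; exact: sum_sin_lazy_step.
Qed.

Lemma cos_avg_lazy_sum0 (t : R) :
  avg (fun w => cos (lazy_sum w * t)) = \prod_j lazy_factor j t.
Proof.
rewrite -[RHS]mul1r -{1}cos0 -(cos_avg_lazy_sum t 0).
by apply: eq_avg => w; rewrite subr0.
Qed.

Lemma lazy_factor_ge0 j t : 0 <= lazy_factor j t.
Proof. by apply: avg_ge0 => l; have := cos_geN1 (2 * (d (j, l) * t)); lra. Qed.

Lemma lazy_factor_le1 j t : lazy_factor j t <= 1.
Proof. by apply: avg_le => // l; have := cos_le1 (2 * (d (j, l) * t)); lra. Qed.

Lemma trig_lazy_factor j : trig (lazy_factor j).
Proof.
apply: trig_avg => l; apply: trigM; last exact: trig_cst.
apply: trigD; first exact: trig_cst.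
by apply: (eq_trig _ (trig_cos (2 * d (j, l)))) => t; rewrite mulrA.
Qed.

Lemma mean_lazy_sum x :
  mean (fun t => avg (fun w => cos (lazy_sum w * t - x * t))) =
  avg (fun w => (lazy_sum w == x)%:R).
Proof.
rewrite (@eq_mean _ _ (fun t => avg (fun w => cos ((lazy_sum w - x) * t)))) => [|t].
  by rewrite mean_avg_cos; apply: eq_avg => w; rewrite subr_eq0.
by apply: eq_avg => w; rewrite mulrBl.
Qed.

(** The characteristic function is nonnegative, so the largest atom is at 0. *)
Lemma lazy_sum_fiber x :
  avg (fun w => (lazy_sum w == x)%:R : R) <= avg (fun w => (lazy_sum w == 0)%:R).
Proof.
have tp : trig (fun t => \prod_j lazy_factor j t).
  by apply: trig_prod => j _; exact: trig_lazy_factor.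
rewrite -!mean_lazy_sum.
rewrite (@eq_mean _ _ (fun t => cos (x * t) * \prod_j lazy_factor j t)); last first.
  by move=> t; rewrite cos_avg_lazy_sum.
rewrite (@eq_mean _ (fun t => avg (fun w => cos (lazy_sum w * t - 0 * t)))
  (fun t => \prod_j lazy_factor j t)); last first.
  by move=> t; rewrite cos_avg_lazy_sum mul0r cos0 mul1r.
apply: ler_mean => // [|t]; first by apply: trigM => //; exact: trig_cos.
rewrite -[leRHS]mul1r; apply: ler_wpM2r; last exact: cos_le1.
by apply: prodr_ge0 => j _; exact: lazy_factor_ge0.
Qed.

Hypothesis d_neq0 : forall s, d s != 0.

(** All factors lie in [0, 1], so P(Y = 0) is at most the mean of a single lazy factor, which is 3/4
    because no step vanishes. *)
Lemma lazy_sum_neq0 : 4^-1 <= avg (fun w => (lazy_sum w != 0)%:R : R).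
Proof.
have le34 : avg (fun w => (lazy_sum w == 0)%:R : R) <= 3 / 4.
  have tp : trig (fun t => \prod_j lazy_factor j t).
    by apply: trig_prod => j _; exact: trig_lazy_factor.
  pose j0 := Ordinal h0.
  have -> : avg (fun w => (lazy_sum w == 0)%:R : R) = mean (fun t => \prod_j lazy_factor j t).
    by rewrite -mean_avg_cos; apply: eq_mean => t; rewrite cos_avg_lazy_sum0.
  apply: (@le_trans _ _ (mean (lazy_factor j0))).
    apply: ler_mean => //; first exact: trig_lazy_factor.
    move=> t; rewrite (bigD1 j0)//= -[leRHS]mulr1; apply: ler_wpM2l.
      exact: lazy_factor_ge0.
    apply: prodr_ile1 => j _; by rewrite lazy_factor_ge0 lazy_factor_le1.
  have tc l : trig (fun t => cos (2 * (d (j0, l) * t))).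
    by apply: (eq_trig _ (trig_cos (2 * d (j0, l)))) => t; rewrite mulrA.
  rewrite mean_avg => [|l].
    apply: avg_le => // l.
    rewrite (@eq_mean _ _ (fun t => 4^-1 * (3 + cos (2 * d (j0, l) * t)))) => [|t].
      rewrite meanZ; last by apply: trigD; [exact: trig_cst|exact: trig_cos].
      rewrite meanD; [|exact: trig_cst|exact: trig_cos].
      rewrite mean_cst mean_cos mulf_eq0 (negbTE (d_neq0 _)) orbF pnatr_eq0 /=.
      lra.
    by rewrite mulrC mulrA.
  by apply: trigM; [apply: trigD => //|]; exact: trig_cst.
have : avg (fun w => (lazy_sum w == 0)%:R : R) + avg (fun w => (lazy_sum w != 0)%:R : R) = 1.
  rewrite -avgD -[RHS](@avg_cst R choice_type 1).
    by apply: eq_avg => w; case: eqP => _; rewrite ?addr0 ?add0r.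
  rewrite card_ffun expn_gt0 !card_prod !muln_gt0 L0 card_ord card_bool //.
by lra.
Qed.

(** Pointwise comparison of characteristic functions: [abs_cos_le] on each factor, then AM-GM inside
    each group. The result is the characteristic function of |L| independent copies of the lazy
    sum. *)
Lemma rademacher_le_lazy (x : R) :
  avg (fun xi : {ffun 'I_h * L -> bool} =>
    (\sum_s (if xi s then - d s else d s) == x)%:R : R) <=
  avg (fun v : {ffun 'I_#|L| -> choice_type} => (\sum_i lazy_sum (v i) == 0)%:R).
Proof.
pose V (xi : {ffun 'I_h * L -> bool}) := \sum_s (if xi s then - d s else d s).
have E1 (t : R) : avg (fun xi => cos ((V xi - x) * t)) = cos (x * t) * \prod_s cos (d s * t).
  rewrite (@eq_avg _ _ _ (fun xi : {ffun 'I_h * L -> bool} =>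
     cos (\sum_s (if xi s then - d s else d s) * t - x * t))) => [|xi]; last first.
    by rewrite mulrBl /V mulr_suml.
  rewrite (@avg_cos_sum R _ _ (fun s e => (if e then - d s else d s) * t)) => [|s].
    congr (_ * _); apply: eq_bigr => s _; rewrite avg_bool mulNr cosN; lra.
  by rewrite big_bool /= mulNr sinN addNr.
have E2 (t : R) : avg (fun v : {ffun 'I_#|L| -> choice_type} =>
     cos ((\sum_i lazy_sum (v i)) * t)) = (\prod_j lazy_factor j t) ^+ #|L|.
  rewrite (@eq_avg _ _ _ (fun v : {ffun 'I_#|L| -> choice_type} =>
     cos (\sum_i lazy_sum (v i) * t - 0))) => [|v]; last first.
    by rewrite subr0 mulr_suml.
  rewrite (@avg_cos_sum R _ _ (fun i w => lazy_sum w * t)) => [|i].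
    by rewrite cos0 mul1r prodr_const card_ord cos_avg_lazy_sum0.
  apply: (@sum_sin_symmetric _ _ choice_flip); first exact: choice_flipK.
  by move=> w; rewrite lazy_sum_flip mulNr.
have -> : avg (fun xi : {ffun 'I_h * L -> bool} => (V xi == x)%:R : R) =
    mean (fun t => cos (x * t) * \prod_s cos (d s * t)).
  rewrite -(eq_mean E1) mean_avg_cos; apply: eq_avg => xi.
  by rewrite subr_eq0.
rewrite -mean_avg_cos (eq_mean E2).
apply: ler_mean.
- apply: trigM; first exact: trig_cos.
  by apply: trig_prod => s _; exact: trig_cos.
- by apply: trigX; apply: trig_prod => j _; exact: trig_lazy_factor.
move=> t; apply: (le_trans (ler_norm _)); rewrite normrM -[leRHS]mul1r.
apply: ler_pM => //; first by rewrite ler_norml cos_geN1 cos_le1.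
rewrite normr_prod.
apply: (@le_trans _ _ (\prod_s ((3 + cos (2 * (d s * t))) / 4))).
  by apply: ler_prod => s _; rewrite normr_ge0 abs_cos_le.
have g0 (s : 'I_h * L) : 0 <= (3 + cos (2 * (d s * t))) / 4.
  by have := cos_geN1 (2 * (d s * t)); lra.
have -> : \prod_s ((3 + cos (2 * (d s * t))) / 4) =
    \prod_j \prod_l ((3 + cos (2 * (d (j, l) * t))) / 4).
  by rewrite pair_bigA; apply: eq_bigr => -[].
rewrite -prodrXl; apply: ler_prod => j _; rewrite prodr_ge0//=.
by apply: prod_le_avg_exp => l.
Qed.

Theorem rademacher_anticoncentration (x : R) :
  avg (fun xi : {ffun 'I_h * L -> bool} =>
    (\sum_s (if xi s then - d s else d s) == x)%:R : R) <=
  8 * avg (fun w => (lazy_sum w == 0)%:R) / Num.sqrt #|L|%:R.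
Proof.
apply: (le_trans (rademacher_le_lazy x)); case: #|L| L0 => // q _.
apply: (@iid_anticoncentration _ _ _ choice_flip) => //.
- exact: choice_flipK.
- exact: lazy_sum_flip.
- exact: lazy_sum_neq0.
- exact: lazy_sum_fiber.
Qed.

End RademacherSums.

(** * From a random permutation to independent samples *)

Section RandomPermutation.
Variable R : realType.

Lemma prob_eqE n (X : 'S_n -> R) x : prob_eq X x = avg (fun pi => (X pi == x)%:R).
Proof.
rewrite avg_indic /prob_eq; congr (_%:R / _); apply: eq_card => pi.
by rewrite inE -[LHS]/(`[< X pi == x >]) asboolb.
Qed.

(** The birthday estimate: the falling factorial is at least n^u (1 - u^2/n), stated without
    division. *)
Lemma ffact_lower u n : (u ^ 2 <= n -> n ^ u * (n - u ^ 2) <= n ^_ u * n)%N.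
Proof.
elim: u => [|u IH] le; first by rewrite ffactn0 expn0 subn0.
have le' : (u ^ 2 <= n)%N by apply: leq_trans le; rewrite leq_exp2r.
rewrite ffactnSr mulnAC.
apply: (@leq_trans (n ^ u * (n - u ^ 2) * (n - u))); last by rewrite leq_mul2r IH// orbT.
rewrite expnS -!mulnA mulnCA leq_mul2l; apply/orP; right.
have u1 : (u.+1 ^ 2 = u ^ 2 + u.*2.+1)%N by rewrite -addn1 sqrnD; lia.
rewrite u1; rewrite u1 in le.
have u2 : (u <= u ^ 2)%N by case: u {IH le le' u1} => // u; rewrite leq_pmulr.
set v := (u ^ 2)%N in le le' u2 *; nia.
Qed.

Lemma expn_le_ffact u n : (2 * u ^ 2 <= n -> n ^ u <= 2 * n ^_ u)%N.
Proof.
move=> le; have [->|n0] := posnP n; first by case: u le => // u _; rewrite exp0n.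
have h := @ffact_lower u n; rewrite -(leq_pmul2r n0).
have le' : (u ^ 2 <= n)%N by lia.
have := h le'; set A := (n ^ u)%N; set B := (n ^_ u)%N; set v := (u ^ 2)%N in le le' *.
move=> H; have : (A * n <= 2 * (A * (n - v)))%N by rewrite mulnCA leq_mul2l; apply/orP; right; lia.
by nia.
Qed.

(** For one member [pi0] of the fibre, every [pi^-1 * pi0] fixes the 2h points of [g], so the fibre
    embeds in the permutations of the remaining points. *)
Lemma card_perm_fiber n h (g : 'I_h * bool -> 'I_n) (f : {ffun 'I_h -> 'I_n * 'I_n}) :
  injective g ->
  (#|[pred pi : 'S_n | [ffun j => (pi^-1 (g (j, true)), pi^-1 (g (j, false)))]%g == f]|
    <= (n - h.*2)`!)%N.
Proof.
move=> ig; set A := [pred pi | _].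
have [pi0 pi0A|A0] := pickP A; last by rewrite (eq_card0 A0).
pose G := [set g x | x : 'I_h * bool].
have cG : #|~: G| = (n - h.*2)%N.
  by rewrite cardsCs finset.setCK card_imset// card_prod !card_ord card_bool muln2.
rewrite -cG -card_perm.
have inj : injective (fun pi : 'S_n => pi^-1 * pi0)%g.
  by move=> p p' /mulIg /invg_inj.
rewrite -(fintype.card_image inj); apply: subset_leq_card; apply/fintype.subsetP => s.
move=> /fintype.imageP[pi piA ->]; rewrite unfold_in; apply/fintype.subsetP => r.
rewrite !inE; apply: contraNN => /imsetP[[j e] _ ->]; apply/eqP; rewrite permM.
move: piA pi0A; rewrite !inE => /eqP <- /eqP /ffunP /(_ j); rewrite !ffunE => -[e1 e2].
by case: e; rewrite -?e1 -?e2 permKV.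
Qed.

(* Sampling without replacement is dominated by twice sampling with
   replacement, as long as the sample is much smaller than [sqrt n]. *)
Lemma avg_perm_le_avg_ffun n h (g : 'I_h * bool -> 'I_n)
    (P : pred {ffun 'I_h -> 'I_n * 'I_n}) :
  injective g -> (8 * h ^ 2 <= n)%N ->
  avg (fun pi : 'S_n =>
    (P [ffun j => (pi^-1 (g (j, true)), pi^-1 (g (j, false)))]%g)%:R : R) <=
  2 * avg (fun f => (P f)%:R).
Proof.
move=> ig hn; pose res (pi : 'S_n) : {ffun 'I_h -> 'I_n * 'I_n} :=
  [ffun j => (pi^-1 (g (j, true)), pi^-1 (g (j, false)))]%g.
rewrite /avg (partition_big res predT)//= card_Sn card_ffun card_prod !card_ord.
(* [expn_le_ffact] with u = 2h, for which [8 * h ^ 2 <= n] reads 2u^2 <= n. *)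
have key : ((n * n) ^ h * (n - h.*2)`! <= 2 * n`!)%N.
  have h2n : (h.*2 <= n)%N.
    by apply: leq_trans hn; rewrite -mul2n; case: h {g P ig res} => // h; nia.
  rewrite -(ffact_fact h2n) mulnA leq_mul2r; apply/orP; right.
  rewrite mulnn -expnM mul2n; apply: expn_le_ffact.
  by rewrite -mul2n expnMn mulnA.
rewrite ler_pdivrMr ?ltr0n ?fact_gt0// mulrA mulrAC ler_pdivlMr; last first.
  rewrite ltr0n expn_gt0 muln_gt0.
  by case: n g P ig hn res key => // g P ig; case: h g P ig => //; nia.
apply: (@le_trans _ _ ((\sum_f (P f)%:R * (n - h.*2)`!%:R) * ((n * n) ^ h)%:R)).
  apply: ler_wpM2r; first exact: ler0n.
  apply: ler_sum => f _.
  rewrite (eq_bigr (fun=> (P f)%:R)) => [|pi /eqP <-//].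
  rewrite sumr_const -[leLHS]mulr_natr; apply: ler_wpM2l; first exact: ler0n.
  by rewrite ler_nat; exact: card_perm_fiber.
rewrite -mulr_suml -mulrA -natrM mulnC [2 * _]mulrC -mulrA -natrM.
apply: ler_wpM2l; first by apply: sumr_ge0 => f _; rewrite ler0n.
by rewrite ler_nat.
Qed.

(** * Exchanging the entries of disjoint pairs of positions *)

Section Swaps.
Variables (n : nat) (S : finType) (p : S * bool -> 'I_n).
Hypothesis p_inj : injective p.

Definition swap_fun (xi : {ffun S -> bool}) (r : 'I_n) : 'I_n :=
  if [pick x | p x == r] is Some x then p (x.1, x.2 (+) xi x.1) else r.

Lemma swap_fun_p xi x : swap_fun xi (p x) = p (x.1, x.2 (+) xi x.1).
Proof.
rewrite /swap_fun; case: pickP => [y /eqP /p_inj ->//|/(_ x)].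
by rewrite eqxx.
Qed.

Lemma swap_fun_out xi r : r \notin codom p -> swap_fun xi r = r.
Proof.
move=> rp; rewrite /swap_fun; case: pickP => [y /eqP e|//].
by rewrite -e codom_f in rp.
Qed.

Lemma swap_funK xi : involutive (swap_fun xi).
Proof.
move=> r; have [/codomP[x ->]|rp] := boolP (r \in codom p).
  by rewrite !swap_fun_p /= addbK -surjective_pairing.
by rewrite !swap_fun_out.
Qed.

Definition swap_perm xi : 'S_n := perm (inv_inj (swap_funK xi)).

Variables (a b : 'I_n -> R).

(** Half the change caused by exchanging the pair: relative to the mean of its two possible
    contributions, the pair adds [swap_gap] if left alone and its negative if exchanged. *)
Definition swap_gap (pi : 'S_n) (s : S) : R :=
  (a (pi^-1%g (p (s, true))) - a (pi^-1%g (p (s, false)))) *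
  (b (p (s, true)) - b (p (s, false))) / 2.

Lemma perm_sum_swap (pi : 'S_n) xi :
  perm_sum a b (pi * swap_perm xi)%g =
  perm_sum a b pi - \sum_s swap_gap pi s +
  \sum_s (if xi s then - swap_gap pi s else swap_gap pi s).
Proof.
pose A r := a (pi^-1%g r).
have psE (tau : 'S_n) : perm_sum a b (pi * tau)%g = \sum_r A r * b (tau r).
  rewrite /perm_sum [RHS](reindex_inj (@perm_inj _ pi)) /=.
  by apply: eq_bigr => i _; rewrite /A permK permM.
have ps1 : perm_sum a b pi = \sum_r A r * b r.
  by rewrite -[pi]mulg1 psE; apply: eq_bigr => r _; rewrite perm1.
rewrite psE ps1 -addrA [- _ + _]addrC -sumrB.
apply/eqP; rewrite addrC -subr_eq -sumrB; apply/eqP.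
rewrite (bigID (mem (codom p))) /= [X in _ + X]big1 ?addr0; last first.
  by move=> r rp; rewrite permE swap_fun_out// subrr.
have -> : \sum_(r in codom p) (A r * b (swap_perm xi r) - A r * b r) =
   \sum_x (A (p x) * b (p (x.1, x.2 (+) xi x.1)) - A (p x) * b (p x)).
  rewrite (eq_bigl (mem [set p x | x : S * bool])); last first.
    by move=> r /=; apply/codomP/imsetP => [[x ->]|[x _ ->]]; exists x.
  rewrite big_imset /=; last by move=> x y _ _; exact: p_inj.
  by apply: eq_big => x; rewrite ?inE// => _; rewrite permE swap_fun_p.
have -> : \sum_x (A (p x) * b (p (x.1, x.2 (+) xi x.1)) - A (p x) * b (p x)) =
   \sum_s \sum_e (A (p (s, e)) * b (p (s, e (+) xi s)) - A (p (s, e)) * b (p (s, e))).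
  by rewrite pair_bigA; apply: eq_bigr => -[].
apply: eq_bigr => s _; rewrite big_bool /swap_gap -!/(A _).
by case: (xi s) => /=; lra.
Qed.

(** Right multiplication by a fixed [swap_perm xi] preserves the uniform law, so independent random
    exchanges may be inserted and [pi] conditioned upon. *)
Lemma avg_perm_sum_swap x :
  avg (fun pi : 'S_n => (perm_sum a b pi == x)%:R : R) =
  avg (fun pi : 'S_n => avg (fun xi : {ffun S -> bool} =>
    (\sum_s (if xi s then - swap_gap pi s else swap_gap pi s) ==
     x - (perm_sum a b pi - \sum_s swap_gap pi s))%:R)).
Proof.
rewrite avg_exchange.
transitivity (avg (fun _ : {ffun S -> bool} =>
    avg (fun pi : 'S_n => (perm_sum a b pi == x)%:R : R))).
  by rewrite avg_cst// card_ffun card_bool expn_gt0.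
apply: eq_avg => xi.
rewrite -(@avg_reindex _ _ _ (fun pi : 'S_n => pi * swap_perm xi)%g); last first.
  by exists (fun pi => pi * (swap_perm xi)^-1)%g => pi; rewrite ?mulgK ?mulgKV.
apply: eq_avg => pi; rewrite perm_sum_swap.
set c := perm_sum a b pi - _; set V := \sum_s _.
by rewrite [V == _]eq_sym subr_eq addrC eq_sym.
Qed.

End Swaps.

(** * Reduction to one characteristic function per group *)

Section PermSumBound.
Variables (n : nat) (a : 'I_n -> R).

(** The characteristic function of D (a - a'), with a uniform [D l] and two independent uniform
    entries of [a]. *)
Definition diff_cf (L : finType) (D : L -> R) (t : R) : R :=
  avg (fun l => avg (fun x : 'I_n * 'I_n => cos (D l * (a x.1 - a x.2) * t))).

Definition lazy_cf (L : finType) (D : L -> R) (t : R) : R := (3 + diff_cf D t) / 4.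

Lemma trig_diff_cf (L : finType) (D : L -> R) : trig (diff_cf D).
Proof. by apply: trig_avg => l; apply: trig_avg => x; exact: trig_cos. Qed.

Lemma trig_lazy_cf (L : finType) (D : L -> R) : trig (lazy_cf D).
Proof.
apply: trigM; last exact: trig_cst.
by apply: trigD; [exact: trig_cst|exact: trig_diff_cf].
Qed.

Lemma lazy_cf_ge0 (L : finType) (D : L -> R) t : 0 <= lazy_cf D t.
Proof.
have : -1 <= diff_cf D t.
  by apply: avg_geN1 => l; apply: avg_geN1 => x; exact: cos_geN1.
by rewrite /lazy_cf; lra.
Qed.

Variables (b : 'I_n -> R) (h : nat) (L : finType) (p : ('I_h * L) * bool -> 'I_n) (rho : R).
Hypotheses (a_inj : injective a) (p_inj : injective p).
Hypotheses (h0 : (0 < h)%N) (L0 : (0 < #|L|)%N) (hn : (8 * h ^ 2 <= n)%N).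

Definition pair_gap (s : 'I_h * L) : R := b (p (s, true)) - b (p (s, false)).

Hypothesis gap_neq0 : forall s, pair_gap s != 0.
Hypothesis rho_ge : forall j, mean (fun t => lazy_cf (fun l => pair_gap (j, l)) t ^+ h) <= rho.

(** Once the choice [w] is fixed, the lazy sum involves only 2h values of [pi^-1], which may be
    sampled independently at the cost of a factor 2. The characteristic function then factors over
    the groups. *)
Lemma avg_lazy_sum_le :
  avg (fun pi : 'S_n => avg (fun w : choice_type h L =>
    (lazy_sum (swap_gap p a b pi) w == 0)%:R)) <= 2 * rho.
Proof.
have n0 : (0 < n)%N by apply: leq_trans hn; rewrite muln_gt0 expn_gt0 h0.
rewrite avg_exchange.
pose Wf (w : choice_type h L) (f : {ffun 'I_h -> 'I_n * 'I_n}) : R :=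
  \sum_j lazy_sign R (w j).2 * pair_gap (j, (w j).1) * (a (f j).1 - a (f j).2).
apply: (@le_trans _ _ (avg (fun w => 2 * avg (fun f => (Wf w f == 0)%:R)))).
  apply: ler_avg => w.
  pose g (x : 'I_h * bool) := p ((x.1, (w x.1).1), x.2).
  have ig : injective g.
    by move=> [j e] [j' e'] /p_inj [-> _ ->].
  apply: le_trans (@avg_perm_le_avg_ffun _ _ g (fun f => Wf w f == 0) ig hn).
  (* The 2 of [lazy_step] cancels the 1/2 of [swap_gap]. *)
  apply: ler_avg => pi; rewrite (_ : lazy_sum _ _ = Wf w [ffun j => (pi^-1 (g (j, true)), pi^-1 (g (j, false)))]%g)//.
  apply: eq_bigr => j _; rewrite ffunE /lazy_step /swap_gap /pair_gap /g /=.
  set x := a _; set y := a _; set u := b _; set v := b _; set s := lazy_sign _ _.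
  by field.
rewrite avgZ; apply: ler_wpM2l => //.
have E (t : R) : avg (fun w => avg (fun f => cos (Wf w f * t))) =
    \prod_j lazy_cf (fun l => pair_gap (j, l)) t.
  transitivity (avg (fun w : {ffun 'I_h -> L * ('I_4 * bool)} => \prod_j
      avg (fun x : 'I_n * 'I_n =>
       cos (lazy_sign R (w j).2 * pair_gap (j, (w j).1) * (a x.1 - a x.2) * t)))).
    apply: eq_avg => w.
    rewrite (@eq_avg _ _ _ (fun f : {ffun 'I_h -> 'I_n * 'I_n} =>
      cos (\sum_j lazy_sign R (w j).2 * pair_gap (j, (w j).1) * (a (f j).1 - a (f j).2) * t - 0))).
      rewrite (@avg_cos_sum R _ _ (fun j (x : 'I_n * 'I_n) =>
        lazy_sign R (w j).2 * pair_gap (j, (w j).1) * (a x.1 - a x.2) * t)).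
        by rewrite cos0 mul1r.
      move=> j; apply: (@sum_sin_symmetric _ _ _ (fun x : 'I_n * 'I_n => (x.2, x.1))).
        by case.
      by case=> x y /=; ring.
    by move=> f; rewrite subr0 /Wf mulr_suml.
  rewrite (avg_ffun (fun j (u : L * ('I_4 * bool)) => avg (fun x : 'I_n * 'I_n =>
       cos (lazy_sign R u.2 * pair_gap (j, u.1) * (a x.1 - a x.2) * t)))).
  apply: eq_bigr => j _; rewrite avg_pair /lazy_cf /diff_cf /=.
  rewrite -(@avg_cst R L 3 L0) -avgD -avgZr; apply: eq_avg => l.
  rewrite (@avg_lazy_sign R (fun s => avg (fun x : 'I_n * 'I_n =>
       cos (s * pair_gap (j, l) * (a x.1 - a x.2) * t)))).
    rewrite (@eq_avg _ _ _ (fun=> 1)) => [|x]; last by rewrite !mul0r cos0.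
    rewrite avg_cst ?card_prod ?card_ord ?muln_gt0 ?n0// mulr1.
    by congr ((_ + _) / _); apply: eq_avg => x; rewrite mul1r.
  by apply: eq_avg => x; rewrite !mulN1r !mulNr cosN mul1r.
have -> : avg (fun w => avg (fun f => (Wf w f == 0)%:R)) =
    mean (fun t => \prod_j lazy_cf (fun l => pair_gap (j, l)) t).
  rewrite -(avg_pair (fun u => (Wf u.1 u.2 == 0)%:R)) -mean_avg_cos.
  by apply: eq_mean => t; rewrite avg_pair E.
have tl j : trig (fun t => lazy_cf (fun l => pair_gap (j, l)) t ^+ h).
  by apply: trigX; exact: trig_lazy_cf.
have rho0 : 0 <= rho.
  apply: le_trans (rho_ge (Ordinal h0)); rewrite -(mean_cst 0).
  by apply: ler_mean => // [|t]; [exact: trig_cst|rewrite exprn_ge0 ?lazy_cf_ge0].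
(* AM-GM over the h groups reduces the product to h-th powers of single factors. *)
apply: (@le_trans _ _ (mean (fun t => avg (fun j =>
    lazy_cf (fun l => pair_gap (j, l)) t ^+ h)))).
  apply: ler_mean; [|exact: trig_avg|] => [|t].
    by apply: trig_prod => j _; exact: trig_lazy_cf.
  have := @prod_le_avg R 'I_h (fun j => lazy_cf (fun l => pair_gap (j, l)) t).
  by rewrite card_ord; apply => // j; exact: lazy_cf_ge0.
by rewrite mean_avg//; apply: avg_le.
Qed.

Theorem perm_sum_anticoncentration x :
  prob_eq (perm_sum a b) x <= 16 * rho / Num.sqrt #|L|%:R.
Proof.
rewrite prob_eqE (avg_perm_sum_swap p_inj a b x).
have gap0 (pi : 'S_n) s : swap_gap p a b pi s != 0.
  rewrite !mulf_neq0 ?invr_eq0//; last exact: gap_neq0.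
  by rewrite subr_eq0; apply/negP => /eqP /a_inj /perm_inj /p_inj.
apply: (@le_trans _ _ (avg (fun pi : 'S_n => 8 / Num.sqrt #|L|%:R *
    avg (fun w : choice_type h L => (lazy_sum (swap_gap p a b pi) w == 0)%:R)))).
  apply: ler_avg => pi.
  apply: (le_trans (rademacher_anticoncentration h0 L0 (gap0 pi) _)).
  by rewrite mulrAC.
rewrite avgZ.
have -> : 16 * rho / Num.sqrt #|L|%:R = 8 / Num.sqrt #|L|%:R * (2 * rho).
  by move: (Num.sqrt _)^-1 => v; ring.
by apply: ler_wpM2l; [rewrite divr_ge0// sqrtr_ge0|exact: avg_lazy_sum_le].
Qed.

End PermSumBound.
End RandomPermutation.

(** * Counting solutions by averages and means *)

Section AverageExtras.
Variable R : realType.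

Lemma avg_at_most_one (T : finType) (P : pred T) :
  (forall x y, P x -> P y -> x = y) -> avg (fun x => (P x)%:R : R) <= #|T|%:R^-1.
Proof.
move=> P1; rewrite avg_indic -[leRHS]mul1r; apply: ler_wpM2r.
  by rewrite invr_ge0.
rewrite (lern1 R); have [x Px|P0] := pickP P; last by rewrite eq_card0.
rewrite -(card1 x); apply: subset_leq_card; apply/fintype.subsetP => y.
by rewrite !inE => Py; apply/eqP; exact: P1.
Qed.

Lemma avg_prod (T U : finType) (F : T -> R) (G : U -> R) :
  avg F * avg G = avg (fun x => avg (fun y => F x * G y)).
Proof. by rewrite -avgZr; apply: eq_avg => x; rewrite avgZ. Qed.

Lemma avg_exchange4 (T T1 T2 T3 T4 : finType) (F : T -> T1 -> T2 -> T3 -> T4 -> R) :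
  avg (fun x => avg (fun x1 => avg (fun x2 => avg (fun x3 => avg (fun x4 => F x x1 x2 x3 x4))))) =
  avg (fun x1 => avg (fun x2 => avg (fun x3 => avg (fun x4 => avg (fun x => F x x1 x2 x3 x4))))).
Proof.
rewrite avg_exchange; apply: eq_avg => x1; rewrite avg_exchange; apply: eq_avg => x2.
by rewrite avg_exchange; apply: eq_avg => x3; rewrite avg_exchange.
Qed.

(** Symmetrising the right-hand side covers each off-diagonal pair once and the diagonal twice,
    which is where the sign of [s x x] enters. *)
Lemma avg_half_le (T : finType) (le : rel T) (s : T -> T -> R) :
  (forall x y, le x y || le y x) -> (forall x y, le x y -> le y x -> x = y) ->
  (forall x y, s x y = s y x) -> (forall x, 0 <= s x x) ->
  avg (fun x => avg (s x)) <= 2 * avg (fun x => avg (fun y => (le x y)%:R * s x y)).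
Proof.
move=> tot anti sym diag.
rewrite mulr2n mulrDl mul1r [X in _ + X]avg_exchange -avgD; apply: ler_avg => x.
rewrite -avgD; apply: ler_avg => y; rewrite [s y x]sym -mulrDl -natrD.
case: (eqVneq x y) => [->|xy].
  have -> : le y y by have := tot y y; rewrite orbb.
  by rewrite ler_peMl// ler1n.
have := tot x y; case lxy: (le x y); case lyx: (le y x) => //= _; rewrite ?mul1r//.
by move: xy; rewrite (anti _ _ lxy lyx) eqxx.
Qed.

(** The product of cosines averages over signs, and the mean detects the equations w ± al ± be =
    0. *)
Lemma mean_cos3 (w al be : R) :
  mean (fun t => cos (w * t) * (cos (al * t) * cos (be * t))) =
  avg (fun e : bool * bool => (w + (-1) ^+ e.1 * al + (-1) ^+ e.2 * be == 0)%:R).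
Proof.
rewrite -mean_avg_cos; apply: eq_mean => t; rewrite avg_pair !avg_bool /= !expr0 !expr1.
rewrite !mulrDl !mul1r !mulNr !mul1r !cosD !sinD !cosN !sinN; lra.
Qed.

Lemma mean_cos2 (w al : R) :
  mean (fun t => cos (w * t) * cos (al * t)) =
  avg (fun e : bool => (w + (-1) ^+ e * al == 0)%:R).
Proof.
rewrite -mean_avg_cos; apply: eq_mean => t; rewrite !avg_bool /= !expr0 !expr1.
rewrite !mulrDl !mul1r !mulNr !mul1r !cosD !cosN !sinN; lra.
Qed.

End AverageExtras.

(** * Decay of high powers of a lazy characteristic function *)

Section LazyPowers.
Variables (R : realType) (n : nat) (a : 'I_n -> R) (L : finType) (D : L -> R).
Hypotheses (n0 : (0 < n)%N) (L0 : (0 < #|L|)%N).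

Lemma lazy_cf0 : lazy_cf a D 0 = 1.
Proof.
rewrite /lazy_cf /diff_cf (@eq_avg _ _ _ (fun=> 1)); last first.
  move=> l; rewrite (@eq_avg _ _ _ (fun=> 1)) => [|x]; last by rewrite mulr0 cos0.
  by rewrite avg_cst// card_prod card_ord muln_gt0 n0.
by rewrite avg_cst//; lra.
Qed.

Lemma posdef_lazy_cf : posdef (lazy_cf a D).
Proof.
apply: posdefM; last by apply: posdef_cst; rewrite invr_ge0.
apply: posdefD; first exact: posdef_cst.
by apply: posdef_avg => l; apply: posdef_avg => x; exact: posdef_cos.
Qed.

(** Each further factor [lazy_cf ^+ k] multiplies the mean by [theta] and adds at most c B, since
    the previous power is a positive combination of cosines with value 1 at 0. The added terms sum
    to a geometric series. *)
Lemma mean_lazy_cf_pow (k r : nat) (theta c B : R) (E : R -> R) :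
  0 <= theta < 1 -> 0 <= c -> 0 <= B -> trig E ->
  (forall t, lazy_cf a D t ^+ k <= theta + c * E t) ->
  (forall w, mean (fun t => cos (w * t) * E t) <= B) ->
  mean (fun t => lazy_cf a D t ^+ (k * r)) <= theta ^+ r + c * B / (1 - theta).
Proof.
move=> /andP[th0 th1] c0 B0 tE Gk EB.
have tl j : trig (fun t => lazy_cf a D t ^+ j) by apply: trigX; exact: trig_lazy_cf.
elim: r => [|r IH].
  rewrite (@eq_mean _ _ (fun=> 1)) => [|t]; last by rewrite muln0.
  by rewrite mean_cst expr0 lerDl divr_ge0 ?mulr_ge0// subr_ge0 ltW.
apply: (@le_trans _ _ (mean (fun t => theta * lazy_cf a D t ^+ (k * r) +
    c * (lazy_cf a D t ^+ (k * r) * E t)))).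
  apply: ler_mean => //.
    by apply: trigD; apply: trigZ => //; exact: trigM.
  move=> t; rewrite mulnS exprD; set x := _ ^+ (k * r).
  have -> : theta * x + c * (x * E t) = (theta + c * E t) * x by ring.
  by apply: ler_wpM2r => //; rewrite exprn_ge0// lazy_cf_ge0.
rewrite meanD; [|exact: trigZ|by apply: trigZ; exact: trigM].
rewrite !meanZ//; last exact: trigM.
have := mean_posdefM_le (posdefX (k * r) posdef_lazy_cf) tE EB.
rewrite lazy_cf0 expr1n mul1r => h1.
have h2 : theta * mean (fun t => lazy_cf a D t ^+ (k * r)) <=
   theta * (theta ^+ r + c * B / (1 - theta)) by apply: ler_wpM2l.
have h3 := ler_wpM2l c0 h1.
have h4 : theta * (theta ^+ r + c * B / (1 - theta)) + c * B =
   theta ^+ r.+1 + c * B / (1 - theta).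
  by rewrite exprS; field; rewrite subr_eq0 gt_eqF.
lra.
Qed.
End LazyPowers.

(** * All gaps equal *)

Section SingleGap.
Variables (R : realType) (n : nat) (a : 'I_n -> R) (L : finType) (D : L -> R) (dl : R).
Hypotheses (n0 : (0 < n)%N) (L0 : (0 < #|L|)%N) (a_inj : injective a).
Hypotheses (dl0 : dl != 0) (Ddl : forall l, D l = dl).

(** [mean_lazy_cf_pow] with [diff_cf] as error: given the frequency, the sign and one entry of [a],
    injectivity leaves at most one choice of the other entry. *)
Lemma mean_lazy_cf_single r :
  mean (fun t => lazy_cf a D t ^+ r) <= (3 / 4) ^+ r + n%:R^-1.
Proof.
have n1 : 0 <= n%:R^-1 :> R by rewrite invr_ge0.
have := @mean_lazy_cf_pow R n a L D n0 L0 1 r (3 / 4) 4^-1 n%:R^-1 (diff_cf a D).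
rewrite mul1n => /(_ _ _ n1 (trig_diff_cf a D)) H.
apply: (le_trans (H _ _ _ _)).
- by apply/andP; split; lra.
- by rewrite invr_ge0.
- by move=> t; rewrite expr1 /lazy_cf; lra.
- move=> w.
  rewrite (@eq_mean _ _ (fun t => avg (fun x : 'I_n * 'I_n =>
      cos (w * t) * cos (dl * (a x.1 - a x.2) * t)))); last first.
    move=> t; rewrite avgZ; congr (_ * _).
    rewrite /diff_cf (@eq_avg _ _ _ (fun=> avg (fun x : 'I_n * 'I_n =>
      cos (dl * (a x.1 - a x.2) * t)))) => [|l]; last by rewrite Ddl.
    by rewrite avg_cst.
  rewrite mean_avg => [|x]; last by apply: trigM; exact: trig_cos.
  rewrite (eq_avg (fun x => mean_cos2 _ _)) avg_exchange; apply: avg_le => // e.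
  rewrite avg_pair avg_exchange; apply: avg_le => // y.
  rewrite -[X in X%:R^-1]card_ord.
  apply: avg_at_most_one => x x' /= /eqP h1 /eqP h2; apply: a_inj.
  have : (-1) ^+ e * dl * (a x - a x') = 0.
    rewrite -[RHS](subrr 0) -{1}h1 -h2; ring.
  move/eqP; rewrite !mulf_eq0 signr_eq0 (negbTE dl0) /= subr_eq0.
  by move/eqP.
have -> : 1 - 3 / 4 = 4^-1 :> R by lra.
by rewrite lerD2l [4^-1 * _]mulrC mulfK ?invr_eq0.
Qed.
End SingleGap.

(** * Many distinct gaps, cut into chunks of 64 *)

Section Chunks.
Variables (R : realType) (n : nat) (a : 'I_n -> R) (I : finType).
Variables (dl : I -> 'I_64 -> R) (lo hi : I -> R) (le : rel I).
Hypotheses (n0 : (0 < n)%N) (I0 : (0 < #|I|)%N) (In : (#|I| <= n)%N) (a_inj : injective a).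
Hypotheses (dl_inj : forall i, injective (dl i)) (dl_in : forall i b, lo i <= dl i b <= hi i).
Hypothesis disj : forall i i' z, lo i <= z <= hi i -> lo i' <= z <= hi i' -> i = i'.
Hypotheses (le_total : forall i i', le i i' || le i' i)
  (le_anti : forall i i', le i i' -> le i' i -> i = i')
  (le_len : forall i i', le i i' -> hi i - lo i <= hi i' - lo i').

Local Notation Xi := ('I_n * 'I_n)%type.
Let X (x : Xi) : R := a x.1 - a x.2.

Definition chunk_cf (t : R) : R :=
  avg (fun i => avg (fun b => avg (fun x : Xi => cos (dl i b * (a x.1 - a x.2) * t)))).

(** The constraints that survive Cauchy-Schwarz: the pair (z, y) has the smaller difference, b
    differs from b2, and both further chunks come after i in the order by length. *)
Definition chunk_ind (i : I) (x' : Xi) (y : 'I_n) (b b2 : 'I_64) (i'' : I) (z : 'I_n)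
    (i' : I) : R :=
  (`|a z - a y| <= `|X x'|)%R%:R * (b != b2)%:R * ((le i i')%:R * (le i i'')%:R).

(** The off-diagonal part of the bound on the eighth power. The variables z, i', b' over which
    solutions are counted are innermost. *)
Definition chunk_err (t : R) : R :=
  avg (fun i => avg (fun x' => avg (fun y => avg (fun b => avg (fun b2 =>
  avg (fun i'' => avg (fun b'' => avg (fun z => avg (fun i' => avg (fun b' =>
    chunk_ind i x' y b b2 i'' z i' *
    (cos ((dl i b - dl i b2) * (a z - a y) * t) *
     cos ((dl i' b' - dl i'' b'') * X x' * t)))))))))))).

Section Pointwise.
Variable t : R.
(** [C] and [S] are the real and imaginary parts of the characteristic function of a random gap of
    chunk i times [X x]; [CU] and [SU] collect the chunks at least i; [g] and [H] are the squared
    moduli. *)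
Let C i x := avg (fun b => cos (dl i b * X x * t)).
Let S i x := avg (fun b => sin (dl i b * X x * t)).
Let CU i x := avg (fun i' => (le i i')%:R * C i' x).
Let SU i x := avg (fun i' => (le i i')%:R * S i' x).
Let g x i := C i x ^+ 2 + S i x ^+ 2.
Let H x i := CU i x ^+ 2 + SU i x ^+ 2.

Lemma chunk_g_ge0 x i : 0 <= g x i.
Proof. by rewrite addr_ge0 ?sqr_ge0. Qed.

Lemma chunk_H_ge0 x i : 0 <= H x i.
Proof. by rewrite addr_ge0 ?sqr_ge0. Qed.

Lemma chunk_g_le1 x i : g x i <= 1.
Proof.
apply: (le_trans (lerD (sqr_avg_le _) (sqr_avg_le _))); rewrite -avgD.
by apply: avg_le => // b; rewrite cos2Dsin2.
Qed.

Lemma chunk_H_le1 x i : H x i <= 1.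
Proof.
apply: (le_trans (lerD (sqr_avg_le _) (sqr_avg_le _))); rewrite -avgD.
apply: avg_le => // i'; have := chunk_g_le1 x i'; rewrite /g.
by case: (le i i'); rewrite ?mul1r ?mul0r ?expr0n ?addr0 ?ler01.
Qed.

(** Cauchy-Schwarz over x, then the squared modulus of the average over chunks is expanded and
    restricted to ordered pairs of chunks by [avg_half_le]. *)
Lemma chunk_cf_sqr : chunk_cf t ^+ 2 <=
  2 * avg (fun x => avg (fun i => C i x * CU i x + S i x * SU i x)).
Proof.
have -> : chunk_cf t = avg (fun x => avg (fun i => C i x)).
  rewrite avg_exchange; apply: eq_avg => i; rewrite avg_exchange.
  by apply: eq_avg => b.
apply: (le_trans (sqr_avg_le _)); rewrite -avgZ; apply: ler_avg => x.
apply: (@le_trans _ _ (avg (fun i => avg (fun i' => C i x * C i' x + S i x * S i' x)))).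
  have -> : avg (fun i => avg (fun i' => C i x * C i' x + S i x * S i' x)) =
      avg (fun i => C i x) ^+ 2 + avg (fun i => S i x) ^+ 2.
    rewrite !expr2 !avg_prod -avgD; apply: eq_avg => i; by rewrite -avgD.
  by rewrite lerDl sqr_ge0.
apply: (le_trans (avg_half_le le_total le_anti _ _)).
- by move=> i i'; rewrite mulrC [S i x * _]mulrC.
- by move=> i; rewrite -!expr2; exact: chunk_g_ge0.
apply: ler_wpM2l => //; apply: ler_avg => i.
rewrite -!avgZ -avgD; apply: ler_avg => i'.
by rewrite mulrDr mulrCA [X in _ + X]mulrCA.
Qed.

(** Cauchy-Schwarz over x and i, and the Lagrange identity for the inner product of (C, S) and (CU,
    SU). *)
Lemma chunk_cf_pow4 : chunk_cf t ^+ 4 <=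
  4 * avg (fun x => avg (fun i => g x i * H x i)).
Proof.
have -> : chunk_cf t ^+ 4 = (chunk_cf t ^+ 2) ^+ 2 by rewrite -exprM.
apply: (@le_trans _ _ ((2 * avg (fun x => avg (fun i => C i x * CU i x + S i x * SU i x))) ^+ 2)).
  have h := chunk_cf_sqr; rewrite ler_pXn2r ?nnegrE ?sqr_ge0//.
  by rewrite (le_trans _ h) ?sqr_ge0.
rewrite exprMn -natrX; apply: ler_wpM2l => //.
apply: (le_trans (sqr_avg_le _)); apply: ler_avg => x.
apply: (le_trans (sqr_avg_le _)); apply: ler_avg => i.
have := sqr_ge0 (C i x * SU i x - S i x * CU i x); rewrite /g /H.
set u1 := C i x; set u2 := S i x; set u3 := CU i x; set u4 := SU i x.
rewrite -subr_ge0 => h; rewrite -subr_ge0.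
have -> // : (u1 ^+ 2 + u2 ^+ 2) * (u3 ^+ 2 + u4 ^+ 2) - (u1 * u3 + u2 * u4) ^+ 2 =
  (u1 * u4 - u2 * u3) ^+ 2 by ring.
by rewrite sqr_ge0.
Qed.

(** A third square doubles x. Of the four factors, all in [0, 1], only [g] at the smaller difference
    and [H] at the larger one are kept. *)
Lemma chunk_cf_pow8 : chunk_cf t ^+ 8 <=
  32 * avg (fun i => avg (fun x => avg (fun x' =>
    (`|X x| <= `|X x'|)%R%:R * (g x i * H x' i)))).
Proof.
have -> : chunk_cf t ^+ 8 = (chunk_cf t ^+ 4) ^+ 2 by rewrite -exprM.
apply: (@le_trans _ _ ((4 * avg (fun x => avg (fun i => g x i * H x i))) ^+ 2)).
  have h := chunk_cf_pow4; have p4 : 0 <= chunk_cf t ^+ 4 by rewrite exprn_even_ge0.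
  by rewrite ler_pXn2r ?nnegrE// (le_trans p4).
rewrite exprMn -natrX avg_exchange.
have -> : 32 = (4 ^ 2)%:R * 2 :> R by rewrite -natrM.
rewrite -mulrA; apply: ler_wpM2l; first exact: ler0n.
apply: (le_trans (sqr_avg_le _)); rewrite -avgZ; apply: ler_avg => i.
rewrite expr2 avg_prod mulr2n mulrDl mul1r [X in _ + X]avg_exchange -avgD.
apply: ler_avg => x; rewrite -avgD; apply: ler_avg => x'.
have := chunk_g_ge0 x i; have := chunk_g_ge0 x' i; have := chunk_H_ge0 x i; have := chunk_H_ge0 x' i.
have := chunk_g_le1 x i; have := chunk_g_le1 x' i; have := chunk_H_le1 x i; have := chunk_H_le1 x' i.
set g1 := g x i; set g2 := g x' i; set h1 := H x i; set h2 := H x' i.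
move=> h21 h11 g21 g11 h20 h10 g20 g10.
have A0 : 0 <= g1 * h2 by rewrite mulr_ge0.
have B0 : 0 <= g2 * h1 by rewrite mulr_ge0.
have A1 : g1 * h2 <= 1 by rewrite mulr_ile1.
have B1 : g2 * h1 <= 1 by rewrite mulr_ile1.
have -> : g1 * h1 * (g2 * h2) = g1 * h2 * (g2 * h1) by ring.
case: (lerP `|X x| `|X x'|) => h; rewrite ?mul1r ?mul0r.
  apply: (@le_trans _ _ (g1 * h2)); first by rewrite ler_piMr.
  by rewrite lerDl mulr_ge0.
by rewrite (ltW h) mul1r add0r ler_piMl.
Qed.

Lemma chunk_H_expand x i : H x i =
  avg (fun i'' => avg (fun b'' => avg (fun i' => avg (fun b' =>
   (le i i')%:R * (le i i'')%:R * cos ((dl i' b' - dl i'' b'') * X x * t))))).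
Proof.
rewrite /H !expr2 {1}/CU {1}/SU.
rewrite !avg_prod -avgD; apply: eq_avg => i''; rewrite -avgD.
transitivity (avg (fun i' => avg (fun b'' => avg (fun b' =>
   (le i i')%:R * (le i i'')%:R * cos ((dl i' b' - dl i'' b'') * X x * t))))); last first.
  by rewrite avg_exchange.
apply: eq_avg => i'.
rewrite mulrACA [X in _ + X]mulrACA -mulrDr !avg_prod -avgD -avgZ; apply: eq_avg => b''.
rewrite -avgD -avgZ; apply: eq_avg => b'.
rewrite [(le i i'')%:R * _]mulrC; congr (_ * _).
by rewrite !mulrBl cosB mulrC [sin _ * sin _]mulrC.
Qed.

Lemma chunk_g_expand x i : g x i = 64^-1 +
  avg (fun b => avg (fun b' => (b != b')%:R * cos ((dl i b - dl i b') * X x * t))).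
Proof.
rewrite /g !expr2 !avg_prod -avgD.
have -> : 64^-1 = avg (fun b : 'I_64 => avg (fun b' : 'I_64 => (b == b')%:R)) :> R.
  rewrite (@eq_avg _ _ _ (fun=> 64^-1)) => [|b]; first by rewrite avg_cst// card_ord.
  by rewrite avg_indic (eq_card (B := pred1 b)) ?card1 ?card_ord ?mul1r// => b'; rewrite !inE eq_sym.
rewrite -avgD; apply: eq_avg => b; rewrite -!avgD; apply: eq_avg => b'.
have -> : cos (dl i b * X x * t) * cos (dl i b' * X x * t) +
   sin (dl i b * X x * t) * sin (dl i b' * X x * t) = cos ((dl i b - dl i b') * X x * t).
  by rewrite !mulrBl cosB.
case: eqP => [->|_] /=; first by rewrite subrr !mul0r cos0 addr0.
by rewrite mul1r add0r.
Qed.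

(** The diagonal b = b' in [g] contributes 1/64, so with 64 gaps per chunk it costs 32/64 = 1/2;
    this determines the chunk size. *)
Lemma chunk_cf_pow8_err : chunk_cf t ^+ 8 <= 2^-1 + 32 * chunk_err t.
Proof.
pose off x i := avg (fun b => avg (fun b' =>
  (b != b')%:R * cos ((dl i b - dl i b') * X x * t))).
have E1 : chunk_err t = avg (fun i => avg (fun x => avg (fun x' =>
    (`|X x| <= `|X x'|)%R%:R * (off x i * H x' i)))).
  apply: eq_avg => i; rewrite [RHS]avg_exchange; apply: eq_avg => x'.
  rewrite [RHS]avg_pair [RHS]avg_exchange; apply: eq_avg => y.
  rewrite -avg_exchange4; apply: eq_avg => z.
  rewrite /off chunk_H_expand -avgZr -avgZ; apply: eq_avg => b.
  rewrite -avgZr -avgZ; apply: eq_avg => b2.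
  rewrite -!avgZ; apply: eq_avg => i''; rewrite -!avgZ; apply: eq_avg => b''.
  rewrite -!avgZ; apply: eq_avg => i'; rewrite -!avgZ; apply: eq_avg => b'.
  by rewrite /chunk_ind {2 3}/X /=; ring.
apply: (le_trans chunk_cf_pow8).
have -> : 2^-1 = 32 * 64^-1 :> R by lra.
rewrite -mulrDr; apply: ler_wpM2l => //; rewrite E1.
apply: (@le_trans _ _ (avg (fun i => avg (fun x => avg (fun x' => 64^-1 +
    (`|X x| <= `|X x'|)%R%:R * (off x i * H x' i)))))).
  apply: ler_avg => i; apply: ler_avg => x; apply: ler_avg => x'.
  rewrite chunk_g_expand -/(off x i) mulrDl mulrDr lerD2r.
  have h0 := chunk_H_ge0 x' i; have h1 := chunk_H_le1 x' i.
  by case: (lerP `|X x| `|X x'|) => _; rewrite ?mul1r ?mul0r ?ler_piMr ?invr_ge0.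
have c0 : 0 <= 64^-1 :> R by rewrite invr_ge0.
apply: (@le_trans _ _ (avg (fun i => 64^-1 + avg (fun x => avg (fun x' =>
    (`|X x| <= `|X x'|)%R%:R * (off x i * H x' i)))))).
  apply: ler_avg => i.
  apply: (@le_trans _ _ (avg (fun x => 64^-1 + avg (fun x' =>
    (`|X x| <= `|X x'|)%R%:R * (off x i * H x' i))))).
    by apply: ler_avg => x; rewrite avgD lerD2r; apply: avg_le.
  by rewrite avgD lerD2r; apply: avg_le.
by rewrite avgD lerD2r; apply: avg_le.
Qed.

End Pointwise.

Lemma trig_chunk_err : trig chunk_err.
Proof.
do 10 (apply: trig_avg => ?); apply: trigM; first exact: trig_cst.
by apply: trigM; exact: trig_cos.
Qed.

(* An interval [lo i', hi i'] at least as long as [y] which meets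
   [z - y, z + y] contains one of the three points [z - y], [z], [z + y]. *)
Lemma chunk_window i (z : R) :
  avg (fun i' => avg (fun b' =>
    (le i i' && (`|dl i' b' - z| <= hi i - lo i))%R%:R : R)) <= 3 / #|I|%:R.
Proof.
set y := hi i - lo i.
have y0 : 0 <= y by have := dl_in i ord0; rewrite /y => /andP[]; lra.
pose at_ z' i' := (lo i' <= z' <= hi i').
have at1 z' : avg (fun i' => (at_ z' i')%:R : R) <= #|I|%:R^-1.
  by apply: avg_at_most_one => i1 i2; exact: disj.
apply: (@le_trans _ _ (avg (fun i' => (at_ (z - y) i')%:R + (at_ z i')%:R +
   (at_ (z + y) i')%:R : R))); last first.
  rewrite !avgD; have := at1 (z - y); have := at1 z; have := at1 (z + y); lra.
apply: ler_avg => i'; apply: avg_le; first by rewrite !addr_ge0.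
move=> b'; case: (boolP (_ && _)) => [/andP[l h]|_]; last by rewrite !addr_ge0.
have := le_len l; rewrite -/y => len; have /andP[d1 d2] := dl_in i' b'.
move: h; rewrite ler_norml => /andP[h1 h2].
rewrite -!natrD ler1n !addn_gt0 !lt0b /at_.
apply/orP; case: (lerP (lo i') (z - y)) => c1; first by left; apply/orP; left; lra.
case: (lerP z (hi i')) => c2.
  case: (lerP (lo i') z) => c3; first by left; apply/orP; right; lra.
  by right; lra.
by left; apply/orP; right; lra.
Qed.

(** If [X x'] is nonzero, the equation and the size constraint put [dl i' b'] within the length of
    chunk i of a fixed point, which leaves 3/|I| of the choices; then z is determined. If [X x']
    vanishes, z = y is forced. *)
Lemma chunk_count (w sg ta : R) i x' y b b2 i'' b'' :
  `|sg| = 1 -> `|ta| = 1 ->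
  avg (fun z => avg (fun i' => avg (fun b' => chunk_ind i x' y b b2 i'' z i' *
    (w + sg * ((dl i b - dl i b2) * (a z - a y)) + ta * ((dl i' b' - dl i'' b'') * X x') == 0)%:R)))
  <= 3 / (#|I| * n)%:R + n%:R^-1 * (x'.1 == x'.2)%:R.
Proof.
move=> sg1 ta1.
have sg0 : sg != 0 by rewrite -normr_eq0 sg1 oner_eq0.
have ta0 : ta != 0 by rewrite -normr_eq0 ta1 oner_eq0.
have ni : 0 <= n%:R^-1 :> R by rewrite invr_ge0.
have p3 : 0 <= 3 / (#|I| * n)%:R :> R by rewrite divr_ge0.
have at1 (P : pred 'I_n) : (forall z z', P z -> P z' -> z = z') ->
    avg (fun z => (P z)%:R : R) <= n%:R^-1.
  by move=> h; rewrite -[X in X%:R^-1]card_ord; exact: avg_at_most_one.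
have [x0|x0] := eqVneq x'.1 x'.2.
  rewrite mulr1 (@le_trans _ _ n%:R^-1) ?lerDr//.
  apply: le_trans (at1 (fun z => z == y) _); last by move=> z z' /eqP -> /eqP.
  apply: ler_avg => z; apply: avg_le => // i'; apply: avg_le => // b'.
  rewrite /chunk_ind /X x0 subrr normr0 normr_le0 subr_eq0 (inj_eq a_inj).
  case: (z == y); rewrite ?mul0r// -!natrM lern1.
  by rewrite !mulnb leq_b1.
rewrite mulr0 addr0.
have X0 : 0 < `|X x'| by rewrite normr_gt0 subr_eq0 (inj_eq a_inj).
have X0' : X x' != 0 by rewrite -normr_gt0.
have [bb|bb] := eqVneq b b2.
  apply: avg_le => // z; apply: avg_le => // i'; apply: avg_le => // b'.
  by rewrite /chunk_ind bb eqxx mulr0 !mul0r.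
have d0 : dl i b - dl i b2 != 0 by rewrite subr_eq0 (inj_eq (@dl_inj i)).
have dle : `|dl i b - dl i b2| <= hi i - lo i.
  by have /andP[? ?] := dl_in i b; have /andP[? ?] := dl_in i b2; rewrite ler_norml; apply/andP; split; lra.
(* The value of [dl i' b'] that would solve the equation for z = y. *)
pose c := dl i'' b'' - w / (ta * X x').
rewrite avg_exchange.
apply: (@le_trans _ _ (avg (fun i' => avg (fun b' =>
    (le i i' && (`|dl i' b' - c| <= hi i - lo i))%R%:R * n%:R^-1)))); last first.
  rewrite (eq_avg (fun i' => avgZr _ _)) avgZr natrM invfM mulrA.
  by apply: ler_wpM2r => //; exact: chunk_window.
apply: ler_avg => i'; rewrite avg_exchange; apply: ler_avg => b'.
pose Q z := w + sg * ((dl i b - dl i b2) * (a z - a y)) + ta * ((dl i' b' - dl i'' b'') * X x') == 0.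
have Qle : avg (fun z => (Q z)%:R : R) <= n%:R^-1.
  apply: at1 => z z' /eqP h1 /eqP h2; apply: a_inj.
  have : sg * (dl i b - dl i b2) * (a z - a z') = 0.
    by rewrite -[RHS](subrr 0) -{1}h1 -h2; ring.
  by move/eqP; rewrite !mulf_eq0 (negbTE sg0) (negbTE d0) /= subr_eq0 => /eqP.
have [win|win] := boolP (le i i' && _).
  rewrite mul1r; apply: le_trans Qle; apply: ler_avg => z; rewrite -/(Q z).
  rewrite -[leRHS]mul1r; apply: ler_wpM2r => //; rewrite /chunk_ind -!natrM lern1.
  by rewrite !mulnb leq_b1.
rewrite mul0r; apply: avg_le => // z; rewrite -/(Q z).
case: (boolP (Q z)) => [/eqP Qz|_]; last by rewrite mulr0.
rewrite mulr1 /chunk_ind.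
case: (lerP `|a z - a y| `|X x'|) => small; last by rewrite !mul0r.
case lii: (le i i'); last by rewrite mul0r mulr0.
exfalso; move/negP: win; apply; rewrite lii /=.
have e : (dl i' b' - c) * (ta * X x') = - (sg * ((dl i b - dl i b2) * (a z - a y))).
  have -> : (dl i' b' - c) * (ta * X x') = ta * ((dl i' b' - dl i'' b'') * X x') + w.
    by rewrite /c; field; rewrite ta0 X0'.
  by apply/eqP; rewrite -subr_eq0 opprK; apply/eqP; rewrite -Qz; ring.
have := congr1 (fun x => `|x|) e; rewrite normrN !normrM ta1 sg1 !mul1r => e2.
rewrite -(ler_pM2r X0) e2; apply: ler_pM => //.
Qed.

Lemma mean_cos_chunk_err w :
  mean (fun t => cos (w * t) * chunk_err t) <= 4 / (#|I| * n)%:R.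
Proof.
pose term i x' y b b2 i'' b'' z i' b' t := chunk_ind i x' y b b2 i'' z i' *
   (cos (w * t) * (cos ((dl i b - dl i b2) * (a z - a y) * t) *
     cos ((dl i' b' - dl i'' b'') * X x' * t))).
have tt i x' y b b2 i'' b'' z i' b' : trig (term i x' y b b2 i'' b'' z i' b').
  by apply: trigZ; do 2 (apply: trigM; [exact: trig_cos|]); exact: trig_cos.
rewrite (@eq_mean _ _ (fun t =>
  avg (fun i => avg (fun x' => avg (fun y => avg (fun b => avg (fun b2 =>
  avg (fun i'' => avg (fun b'' => avg (fun z => avg (fun i' => avg (fun b' =>
    term i x' y b b2 i'' b'' z i' b' t))))))))))));
  last first.
  move=> t; rewrite /chunk_err; do 10 (rewrite -avgZ; apply: eq_avg => ?).
  by rewrite /term; ring.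
have In0 : (#|I| * n)%:R^-1 = #|I|%:R^-1 * n%:R^-1 :> R by rewrite natrM invfM.
have c0 : 0 <= 3 / (#|I| * n)%:R :> R by rewrite divr_ge0.
have c1 : 0 <= n%:R^-1 :> R by rewrite invr_ge0.
rewrite mean_avg => [|i]; last by do 9 (apply: trig_avg => ?).
apply: avg_le => [|i]; first by rewrite divr_ge0.
apply: (@le_trans _ _ (avg (fun x' : Xi => 3 / (#|I| * n)%:R + n%:R^-1 * (x'.1 == x'.2)%:R))).
  rewrite mean_avg => [|x']; last by do 8 (apply: trig_avg => ?).
  apply: ler_avg => x'.
  have cc : 0 <= 3 / (#|I| * n)%:R + n%:R^-1 * (x'.1 == x'.2)%:R :> R.
    by rewrite addr_ge0// mulr_ge0.
  rewrite mean_avg => [|y]; last by do 7 (apply: trig_avg => ?).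
  apply: avg_le => // y.
  rewrite mean_avg => [|b]; last by do 6 (apply: trig_avg => ?).
  apply: avg_le => // b.
  rewrite mean_avg => [|b2]; last by do 5 (apply: trig_avg => ?).
  apply: avg_le => // b2.
  rewrite mean_avg => [|i'']; last by do 4 (apply: trig_avg => ?).
  apply: avg_le => // i''.
  rewrite mean_avg => [|b'']; last by do 3 (apply: trig_avg => ?).
  apply: avg_le => // b''.
  rewrite mean_avg => [|z]; last by do 2 (apply: trig_avg => ?).
  have -> : avg (fun z => mean (fun t => avg (fun i' => avg (fun b' =>
      term i x' y b b2 i'' b'' z i' b' t)))) =
    avg (fun e : bool * bool => avg (fun z => avg (fun i' => avg (fun b' =>
      chunk_ind i x' y b b2 i'' z i' *
      (w + (-1) ^+ e.1 * ((dl i b - dl i b2) * (a z - a y)) +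
       (-1) ^+ e.2 * ((dl i' b' - dl i'' b'') * X x') == 0)%:R)))).
    rewrite [RHS]avg_exchange; apply: eq_avg => z; rewrite [RHS]avg_exchange.
    rewrite mean_avg => [|i']; last by apply: trig_avg.
    apply: eq_avg => i'; rewrite [RHS]avg_exchange mean_avg//; apply: eq_avg => b'.
    rewrite /term meanZ; last by do 2 (apply: trigM; [exact: trig_cos|]); exact: trig_cos.
    by rewrite mean_cos3 avgZ.
  apply: avg_le => // e; apply: chunk_count; exact: normr_sign.
(* The diagonal of x' has weight 1/n, at most 1/|I|, which accounts for the fourth unit. *)
rewrite avgD [X in _ + X]avgZ avg_cst ?card_prod ?card_ord ?muln_gt0 ?n0//.
have d1 : avg (fun x' : Xi => (x'.1 == x'.2)%:R : R) <= #|I|%:R^-1.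
  rewrite avg_pair; apply: (@le_trans _ _ n%:R^-1); last first.
    by rewrite lef_pV2 ?posrE ?ltr0n// ler_nat.
  apply: avg_le => // z; rewrite -[X in X%:R^-1]card_ord.
  by apply: avg_at_most_one => u v /= /eqP <- /eqP <-.
have := ler_wpM2l c1 d1; rewrite In0 [n%:R^-1 * #|I|%:R^-1]mulrC.
set P := #|I|%:R^-1 * n%:R^-1; set Q := n%:R^-1 * _; lra.
Qed.

Variables (L : finType) (D : L -> R).
Hypotheses (L0 : (0 < #|L|)%N) (DE : forall t, diff_cf a D t = chunk_cf t).

(** Three uses of ((3+u)/4)^2 <= (3+u^2)/4 give [lazy_cf ^+ 8] <= (3 + f^8)/4 <= 7/8 + 8
    [chunk_err]; then 8 times 4/(|I| n) divided by 1 - 7/8 is the error. *)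
Lemma mean_lazy_cf_chunks r :
  mean (fun t => lazy_cf a D t ^+ (8 * r)) <= (7 / 8) ^+ r + 256 / (#|I| * n)%:R.
Proof.
have B0 : 0 <= 4 / (#|I| * n)%:R :> R by rewrite divr_ge0.
apply: (le_trans (@mean_lazy_cf_pow R n a L D n0 L0 8 r (7 / 8) 8 _ chunk_err _ _ B0
  trig_chunk_err _ mean_cos_chunk_err)).
- by apply/andP; split; lra.
- by [].
- move=> t; have sq (u : R) : ((3 + u) / 4) ^+ 2 <= (3 + u ^+ 2) / 4.
    by have := sqr_ge0 (u - 1); rewrite sqrrB1 !expr2; lra.
  have := chunk_cf_pow8_err t; rewrite /lazy_cf DE; set f := chunk_cf t => f8.
  have e8 (u : R) : u ^+ 8 = ((u ^+ 2) ^+ 2) ^+ 2 by rewrite -!exprM.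
  have s1 := sq f; have s2 := sq (f ^+ 2); have s3 := sq ((f ^+ 2) ^+ 2).
  have m2 (u v : R) : 0 <= u -> u <= v -> u ^+ 2 <= v ^+ 2.
    by move=> u0 uv; rewrite ler_pXn2r ?nnegrE// (le_trans u0).
  have s4 := m2 _ _ (sqr_ge0 _) s1.
  have s5 := m2 _ _ (sqr_ge0 _) (le_trans s4 s2).
  have s6 := le_trans s5 s3.
  by move: s6; rewrite -!e8; move: f8; lra.
have -> : 1 - 7 / 8 = 8^-1 :> R by lra.
by rewrite lerD2l invrK; move: (_%:R^-1) => v; lra.
Qed.
End Chunks.

(** * The multiplicity profile and its dominant level *)

Section Profile.
Variables (R : realType) (n : nat) (b : 'I_n -> R).
Local Notation mu := (mult_profile b).

Lemma sum_count_undup (T : eqType) (s : seq T) :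
  (\sum_(v <- undup s) count_mem v s)%N = size s.
Proof.
transitivity (\sum_(v <- undup s) \sum_(x <- s) (x == v : nat))%N.
  by apply: eq_bigr => v _; rewrite -sum1_count big_mkcond; apply: eq_bigr => x _ /=; case: eqP.
rewrite exchange_big /= -sum1_size big_seq [RHS]big_seq; apply: eq_bigr => x xs.
transitivity (count_mem x (undup s)).
  by rewrite -sum1_count [RHS]big_mkcond; apply: eq_bigr => v _ /=; rewrite eq_sym; case: eqP.
by rewrite count_uniq_mem ?undup_uniq// mem_undup xs.
Qed.

Lemma perm_mult_profile :
  perm_eq mu [seq count_mem v (codom b) | v <- distinct_vals b].
Proof. by rewrite perm_sort. Qed.

Lemma sumn_mult_profile : sumn mu = n.
Proof.
rewrite (perm_sumn perm_mult_profile) sumnE big_map sum_count_undup.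
by rewrite size_codom card_ord.
Qed.

Lemma size_mult_profile : (size mu <= n)%N.
Proof.
rewrite (perm_size perm_mult_profile) size_map.
by apply: (leq_trans (size_undup _)); rewrite size_codom card_ord.
Qed.

Lemma mult_profile_le k : (nth 0%N mu k <= n)%N.
Proof.
have [lt|ge] := ltnP k (size mu); last by rewrite nth_default.
have : nth 0%N mu k \in mu by rewrite mem_nth.
rewrite (perm_mem perm_mult_profile) => /mapP[v _ ->].
by apply: (leq_trans (count_size _ _)); rewrite size_codom card_ord.
Qed.

Lemma mult_profile_sorted k k' : (k' < size mu)%N -> (k <= k')%N ->
  (nth 0%N mu k' <= nth 0%N mu k)%N.
Proof.
move=> k's kk'; have sm : sorted geq mu by apply: sort_sorted => x y; exact: leq_total.
apply: (@sorted_leq_nth _ geq _ _ 0%N _ sm k k') => //.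
- by move=> x y z /= h1 h2; exact: leq_trans h2 h1.
- exact: leqnn.
- exact: leq_ltn_trans k's.
Qed.

Lemma count_codom v : count_mem v (codom b) = #|[pred i | b i == v]|.
Proof. by rewrite codomE count_map -sum1_count big_enum_cond -sum1_card. Qed.

(** The first k + 1 entries of the decreasing profile are at least its entry k; the corresponding
    values are listed in increasing order. *)
Lemma frequent_values k : (k < size mu)%N -> exists val : nat -> R,
  (forall i j, (i < j <= k)%N -> val i < val j) /\
  (forall i, (i <= k)%N -> (nth 0%N mu k <= #|[pred r | b r == val i]|)%N).
Proof.
move=> ks; set m := nth 0%N mu k.
pose vs := [seq v <- distinct_vals b | (m <= count_mem v (codom b))%N].
have svs : (k < size vs)%N.
  rewrite size_filter.
  have -> : count (fun v => m <= count_mem v (codom b))%N (distinct_vals b) = count (leq m) mu.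
    by rewrite (seq.permP perm_mult_profile) count_map.
  rewrite -(cat_take_drop k.+1 mu) count_cat.
  have -> : count (leq m) (take k.+1 mu) = k.+1.
    rewrite -[RHS](@size_takel k.+1 _ mu)//; apply/eqP; rewrite -all_count.
    apply/(all_nthP 0%N) => i; rewrite size_takel// => ik; rewrite nth_take//.
    exact: mult_profile_sorted.
  by rewrite leq_addr.
pose s := sort <=%R vs.
have ss : size s = size vs by rewrite size_sort.
have lt_s : sorted <%R s by rewrite sort_lt_sorted filter_uniq// undup_uniq.
exists (nth 0 s); split.
  move=> i j /andP[ij jk]; rewrite (lt_sorted_ltn_nth 0 lt_s)// inE ss.
    by apply: leq_ltn_trans svs; apply: leq_trans jk; exact: ltnW.
  exact: leq_ltn_trans svs.
move=> i ik; rewrite -count_codom.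
have : nth 0 s i \in s by rewrite mem_nth// ss; exact: leq_ltn_trans svs.
by rewrite mem_sort mem_filter => /andP[].
Qed.

(** The i-th smallest value is paired with the i-th largest, in m copies. The pairs are nested, so
    the gaps strictly decrease; for even k the middle value stays unpaired. *)
Lemma gap_data k : (0 < k < size mu)%N ->
  exists (q : 'I_(k.+1./2) * 'I_(nth 0%N mu k) * bool -> 'I_n) (dl : nat -> R),
  [/\ injective q,
      forall x, b (q (x, true)) - b (q (x, false)) = dl x.1,
      forall i, (i < k.+1./2)%N -> 0 < dl i &
      forall i j, (i < j < k.+1./2)%N -> dl j < dl i].
Proof.
move=> /andP[k0 ks]; have [val [vlt vcnt]] := frequent_values ks.
set m := nth 0%N mu k in vcnt *.
have n0 : (0 < n)%N by apply: leq_trans size_mult_profile; exact: leq_ltn_trans ks.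
pose pos (v : R) (c : nat) : 'I_n := nth (Ordinal n0) (enum [pred r | b r == v]) c.
have posb i c : (i <= k)%N -> (c < m)%N -> b (pos (val i) c) = val i.
  move=> ik cm; have : pos (val i) c \in enum [pred r | b r == val i].
    by rewrite mem_nth// -cardE; exact: leq_trans (vcnt i ik).
  by rewrite mem_enum inE => /eqP.
have pos_inj i c c' : (i <= k)%N -> (c < m)%N -> (c' < m)%N ->
    pos (val i) c = pos (val i) c' -> c = c'.
  move=> ik cm cm' /eqP; have := vcnt i ik; rewrite cardE => sz.
  by rewrite nth_uniq ?enum_uniq ?(leq_trans cm sz) ?(leq_trans cm' sz)// => /eqP.
have val_inj i j : (i <= k)%N -> (j <= k)%N -> val i = val j -> i = j.
  move=> ik jk e; case: (ltngtP i j) => // h.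
    by have := vlt i j; rewrite h jk e ltxx => /(_ isT).
  by have := vlt j i; rewrite h ik e ltxx => /(_ isT).
pose ix (i : nat) (e : bool) := if e then (k - i)%N else i.
have ixk i e : (i < k.+1./2)%N -> (ix i e <= k)%N.
  by rewrite /ix; case: e => h; [exact: leq_subr|lia].
have ix_inj i e j e' : (i < k.+1./2)%N -> (j < k.+1./2)%N -> ix i e = ix j e' -> i = j /\ e = e'.
  by rewrite /ix; case: e; case: e' => h1 h2 h3; split; lia.
exists (fun x : 'I_(k.+1./2) * 'I_m * bool => pos (val (ix x.1.1 x.2)) x.1.2),
  (fun i => val (k - i)%N - val i); split.
- move=> [[i c] e] [[j c'] e'] /= E.
  have bi := posb _ _ (ixk i e (ltn_ord i)) (ltn_ord c).
  have bj := posb _ _ (ixk j e' (ltn_ord j)) (ltn_ord c').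
  have [ij ee] := ix_inj _ _ _ _ (ltn_ord i) (ltn_ord j)
    (val_inj _ _ (ixk _ _ (ltn_ord i)) (ixk _ _ (ltn_ord j))
      (etrans (esym bi) (etrans (congr1 b E) bj))).
  move/ord_inj: ij => ij; subst j e'.
  by have /ord_inj -> := pos_inj _ _ _ (ixk i e (ltn_ord i)) (ltn_ord c) (ltn_ord c') E.
- by move=> [i c] /=; rewrite !posb ?(ixk _ true) ?(ixk _ false).
- by move=> i ik; rewrite subr_gt0; apply: vlt; lia.
- move=> i j /andP[ij jk].
  have h1 : val i < val j by apply: vlt; lia.
  have h2 : val (k - j)%N < val (k - i)%N by apply: vlt; lia.
  by lra.
Qed.

Lemma harmonic_le l N : (N < 2 ^ l)%N -> \sum_(1 <= j < N.+1) j%:R^-1 <= l%:R :> R.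
Proof.
elim: l N => [|l IH] N; first by rewrite expn0 ltnS leqn0 => /eqP ->; rewrite big_geq.
move=> Nl; have [lt|ge] := ltnP N (2 ^ l).
  by apply: (le_trans (IH _ lt)); rewrite ler_nat.
have p0 : (0 < 2 ^ l)%N by rewrite expn_gt0.
rewrite (@big_cat_nat _ _ _ (2 ^ l))//=; last exact: leqW.
rewrite -natr1; apply: lerD.
  by have := IH (2 ^ l).-1; rewrite prednK// leqnn; apply.
rewrite big_nat.
apply: (@le_trans _ _ (\sum_(2 ^ l <= j < N.+1) (2 ^ l)%:R^-1)).
  rewrite [leRHS]big_nat; apply: ler_sum => j /andP[jl _].
  by rewrite lef_pV2 ?posrE ?ltr0n ?ler_nat// (leq_trans p0).
rewrite sumr_const_nat -[leLHS]mulr_natr mulrC ler_pdivrMr ?ltr0n// mul1r ler_nat.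
by move: Nl; rewrite expnS; lia.
Qed.

(** For k maximising k^3 mu_k, each term j^2 mu_j is at most that maximum divided by j, and the
    harmonic sum costs a factor l. *)
Lemma dominant_level l : (n < 2 ^ l)%N -> (0 < Mprof b)%N ->
  exists2 k, (0 < k < size mu)%N & (Mprof b <= l * (k ^ 3 * nth 0%N mu k))%N.
Proof.
move=> nl M0; pose F (k : 'I_(size mu)) := (k ^ 3 * nth 0%N mu k)%N.
have s0 : (0 < size mu)%N.
  by rewrite lt0n; apply: contraTneq M0; rewrite /Mprof => ->; rewrite big_ord0.
case: (@arg_maxnP _ (Ordinal s0) predT F isT) => k _ kmax.
have key : (Mprof b)%:R <= l%:R * (F k)%:R :> R.
  have step (j : 'I_(size mu)) : (j ^ 2 * nth 0%N mu j)%:R <= (F k)%:R * j%:R^-1 :> R.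
    have [->|j0] := posnP j; first by rewrite mul0n mulr_ge0 ?invr_ge0.
    rewrite ler_pdivlMr ?ltr0n// -natrM ler_nat mulnAC -expnSr; exact: kmax.
  rewrite /Mprof natr_sum; apply: (le_trans (ler_sum _ (fun j _ => step j))).
  rewrite -mulr_sumr mulrC; apply: ler_wpM2r; first exact: ler0n.
  apply: (le_trans _ (@harmonic_le l n nl)).
  rewrite -(big_mkord xpredT (fun j => j%:R^-1)) big_ltn// invr0 add0r.
  rewrite [leRHS](@big_cat_nat _ _ _ (size mu))//=; last first.
    by apply: leqW; exact: size_mult_profile.
  by rewrite lerDl; apply: sumr_ge0 => j _; rewrite invr_ge0.
exists k; last by move: key; rewrite -natrM ler_nat.
rewrite ltn_ord andbT lt0n; apply: contraTneq M0 => k0.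
by move: key; rewrite /F k0 mul0n mulr0 (ler_nat _ _ 0) leqn0 => /eqP ->.
Qed.

(** Every entry of b other than the most frequent value contributes at least 1 to M(B). *)
Lemma Mprof_ge_tail : (n <= nth 0%N mu 0 + Mprof b)%N.
Proof.
rewrite -{1}sumn_mult_profile sumnE (big_nth 0%N) big_mkord /Mprof.
case: (size mu) => [|s]; first by rewrite !big_ord0.
rewrite !big_ord_recl /= leq_add2l mul0n add0n; apply: leq_sum => j _.
by rewrite /bump /= add1n leq_pmull// expn_gt0.
Qed.

End Profile.

(** * One value occurring very often *)

Section DominantValue.
Variables (R : realType) (n : nat) (a b : 'I_n -> R) (p0 : 'I_n) (v : R).
Hypotheses (a_inj : injective a) (bp0 : b p0 != v).

Lemma perm_sum_tperm (pi : 'S_n) r : b r = v ->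
  perm_sum a b (pi * tperm p0 r)%g =
  perm_sum a b pi + (a (pi^-1%g r) - a (pi^-1%g p0)) * (b p0 - v).
Proof.
move=> br; pose A r := a (pi^-1%g r).
have psE (tau : 'S_n) : perm_sum a b (pi * tau)%g = \sum_r A r * b (tau r).
  rewrite /perm_sum [RHS](reindex_inj (@perm_inj _ pi)) /=.
  by apply: eq_bigr => i _; rewrite /A permK permM.
have ps1 : perm_sum a b pi = \sum_r A r * b r.
  by rewrite -[pi]mulg1 psE; apply: eq_bigr => i _; rewrite perm1.
have rp : r != p0 by apply: contra bp0 => /eqP <-; rewrite br.
rewrite psE ps1 (bigD1 p0)//= [X in _ = X + _](bigD1 p0)//= tpermL.
rewrite (bigD1 r)//= [X in _ = _ + X + _](bigD1 r)//= tpermR br -!/(A _).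
rewrite [X in _ + (_ + X)](eq_bigr (fun i => A i * b i)) => [|i /andP[ip ir]]; last first.
  by rewrite tpermD// eq_sym.
by set u := \sum_(_ | _) _; ring.
Qed.

(** Exchanging position p0 with the various positions of v gives pairwise distinct sums, so for each
    [pi] at most one of these exchanges yields x. *)
Lemma dominant_value_bound x : (0 < #|[pred r | b r == v]|)%N ->
  prob_eq (perm_sum a b) x <= #|[pred r | b r == v]|%:R^-1.
Proof.
move=> Z0; set Z := [pred r | b r == v] in Z0 *.
rewrite prob_eqE /avg ler_pdivrMr; last by rewrite card_Sn ltr0n fact_gt0.
rewrite mulrC ler_pdivlMr ?ltr0n// mulr_natr.
have -> : (\sum_(pi : 'S_n) (perm_sum a b pi == x)%:R) *+ #|Z| =
    \sum_(r in Z) \sum_(pi : 'S_n) (perm_sum a b (pi * tperm p0 r)%g == x)%:R :> R.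
  rewrite -sumr_const; apply: eq_bigr => r _.
  by rewrite [LHS](reindex_inj (mulIg (tperm p0 r))).
rewrite exchange_big /=; apply: (@le_trans _ _ (\sum_(pi : 'S_n) 1)); last by rewrite sumr_const.
apply: ler_sum => pi _; rewrite -natr_sum lern1.
have [r0 /andP[r0Z /eqP r0x]|none] := pickP [pred r | (r \in Z) && (perm_sum a b (pi * tperm p0 r)%g == x)].
  rewrite (bigD1 r0)//= r0x eqxx big1// => r /andP[rZ rr0].
  case: eqP => // rx; move: rr0; rewrite -(inj_eq (@perm_inj _ pi^-1%g)) -(inj_eq a_inj).
  move: r0x rx; rewrite !perm_sum_tperm; [|exact/eqP|exact/eqP].
  set u := a (_ r0); set w := a (_ r); set u0 := a (_ p0) => h1 h2.
  have : (w - u) * (b p0 - v) = 0.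
    by rewrite -[RHS](subrr x) -{1}h2 -h1; ring.
  by move/eqP; rewrite mulf_eq0 !subr_eq0 (negbTE bp0) orbF => ->.
by rewrite big1// => r rZ; have := none r; rewrite /= rZ /= => ->.
Qed.
End DominantValue.

(** * Probability bounds from many gaps or from one gap *)

Section GapCases.
Variables (R : realType) (n l k : nat) (a b : 'I_n -> R).
Local Notation mu := (mult_profile b).
Local Notation K := (k.+1./2).
Local Notation m := (nth 0%N (mult_profile b) k).
Local Notation h := (8 * (12 * l))%N.
Hypotheses (a_inj : injective a) (l0 : (0 < l)%N) (nl : (n < 2 ^ l)%N).
Hypotheses (ks : (0 < k < size mu)%N) (hn : (8 * h ^ 2 <= n)%N).

Lemma gap_n_gt0 : (0 < n)%N.
Proof. by apply: leq_trans hn; rewrite muln_gt0 expn_gt0 !muln_gt0 l0. Qed.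

(** (7/8)^12 <= 1/4 and n < 2^l. This explains the number of groups h = 8 (12 l): an eighth power,
    raised to 12 l. *)
Lemma lazy_decay : (7 / 8) ^+ (12 * l) <= (n%:R ^+ 2)^-1 :> R.
Proof.
have e4 : (7 / 8) ^+ 4 <= 3 / 5 :> R by rewrite !exprS expr0; lra.
have e12 : (7 / 8) ^+ 12 <= 4^-1 :> R.
  have -> : (7 / 8) ^+ 12 = ((7 / 8) ^+ 4) ^+ 3 :> R by rewrite -exprM.
  apply: (@le_trans _ _ ((3 / 5) ^+ 3)); last by rewrite !exprS expr0; lra.
  by rewrite ler_pXn2r// nnegrE ?exprn_ge0//; lra.
rewrite exprM; apply: (@le_trans _ _ (4^-1 ^+ l)).
  by rewrite ler_pXn2r// nnegrE ?exprn_ge0 ?invr_ge0//; lra.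
rewrite exprVn lef_pV2 ?posrE ?exprn_gt0 ?ltr0n ?gap_n_gt0//.
have -> : 4 = 2 ^+ 2 :> R by rewrite -natrX.
rewrite -exprM mulnC exprM ler_pXn2r ?nnegrE//.
by rewrite -natrX ler_nat ltnW.
Qed.

Section ChunkCase.
Variables (K2 m' : nat) (st : 'I_h -> 'I_K2 -> nat) (co : 'I_h -> 'I_m' -> nat).
Hypotheses (K20 : (0 < K2)%N) (m'0 : (0 < m')%N) (K2n : (K2 <= n)%N).
Hypothesis st_lt : forall j i, (64 * st j i + 63 < K)%N.
Hypothesis co_lt : forall j c, (co j c < m)%N.
Hypothesis stco_inj : forall j i c j' i' c', st j i = st j' i' -> co j c = co j' c' ->
  [/\ j = j', i = i' & c = c'].

Lemma chunk_slot_lt j i (bb : 'I_64) : (64 * st j i + bb < K)%N.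
Proof.
apply: leq_ltn_trans (st_lt j i); rewrite leq_add2l -ltnS; exact: ltn_ord.
Qed.

(** Group j receives the chunks [st j i] in the copies [co j c], hence 64 K2 m' pairs. With rho =
    257/(K2 n), the bound 16 rho / sqrt(64 K2 m') is 514 / (n sqrt(K2^3 m')). *)
Lemma chunk_case x :
  prob_eq (perm_sum a b) x <= 2 ^+ 10 / (n%:R * Num.sqrt (K2%:R ^+ 3 * m'%:R)).
Proof.
have n0 := gap_n_gt0; have [q [dl [q_inj qgap dl0 dl_dec]]] := gap_data ks.
pose L : finType := (('I_K2 * 'I_64) * 'I_m')%type.
pose p (u : ('I_h * L) * bool) : 'I_n :=
  q ((Ordinal (chunk_slot_lt u.1.1 u.1.2.1.1 u.1.2.1.2), Ordinal (co_lt u.1.1 u.1.2.2)), u.2).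
have st_inj j : injective (st j).
  by move=> i i' e; have [] := stco_inj (c := Ordinal m'0) (c' := Ordinal m'0) e erefl.
have p_inj : injective p.
  move=> [[j [[i bb] c]] e] [[j' [[i' bb'] c']] e'] /q_inj [] /= E1 E2 ->.
  have lt1 := ltn_ord bb; have lt2 := ltn_ord bb'.
  have ebb : bb = bb' by apply: ord_inj; lia.
  have est : st j i = st j' i' by rewrite ebb in E1; lia.
  by have [-> -> ->] := stco_inj est E2; rewrite ebb.
have gapE s : pair_gap b p s = dl (64 * st s.1 s.2.1.1 + s.2.1.2)%N.
  by rewrite /pair_gap /p qgap.
have h0 : (0 < h)%N by rewrite !muln_gt0 l0.
have cL : #|L| = (K2 * 64 * m')%N by rewrite !card_prod !card_ord.
have L0 : (0 < #|L|)%N by rewrite cL !muln_gt0 K20 m'0.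
have gap_neq0 s : pair_gap b p s != 0 by rewrite gapE gt_eqF// dl0// chunk_slot_lt.
have K2n0 : 0 < (K2 * n)%:R :> R by rewrite ltr0n muln_gt0 K20.
have dl_le i j : (i <= j)%N -> (j < K)%N -> dl j <= dl i.
  rewrite leq_eqVlt => /orP[/eqP ->//|ij jK]; apply: ltW; apply: dl_dec.
  by rewrite ij.
have rho_ge j : mean (fun t => lazy_cf a (fun l => pair_gap b p (j, l)) t ^+ h) <=
    257 / (K2 * n)%:R.
  (* Gaps decrease with the index, so a chunk starts at its largest gap. *)
  pose hi i := dl (64 * st j i)%N; pose lo i := dl (64 * st j i + 63)%N.
  pose len i := hi i - lo i.
  (* Ties in length are broken by the index, to make the order antisymmetric. *)
  pose le (i i' : 'I_K2) := (len i < len i') || ((len i == len i') && (i <= i')%N).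
  apply: (@le_trans _ _ ((7 / 8) ^+ (12 * l) + 256 / (#|'I_K2| * n)%:R)); last first.
    rewrite card_ord; apply: (@le_trans _ _ ((n%:R ^+ 2)^-1 + 256 / (K2 * n)%:R)).
      by rewrite lerD2r lazy_decay.
    have : (n%:R ^+ 2)^-1 <= (K2 * n)%:R^-1 :> R.
      rewrite lef_pV2 ?posrE// ?exprn_gt0 ?ltr0n// expr2 -natrM ler_nat.
      by rewrite leq_mul2r K2n orbT.
    by move: (K2 * n)%:R^-1 => v; lra.
  apply: (@mean_lazy_cf_chunks R n a 'I_K2 (fun i bb => dl (64 * st j i + bb)%N) lo hi le) => //.
  - by rewrite card_ord.
  - by rewrite card_ord.
  - move=> i bb bb' /= E; apply: ord_inj.
    have s1 := chunk_slot_lt j i bb; have s2 := chunk_slot_lt j i bb'.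
    case: (ltngtP bb bb') => // c.
      have := @dl_dec (64 * st j i + bb)%N (64 * st j i + bb')%N.
      by rewrite E ltxx ltn_add2l c s2 => /(_ isT).
    have := @dl_dec (64 * st j i + bb')%N (64 * st j i + bb)%N.
    by rewrite E ltxx ltn_add2l c s1 => /(_ isT).
  - move=> i bb; apply/andP; split.
      by apply: dl_le => //; rewrite leq_add2l -ltnS; exact: ltn_ord.
    by apply: dl_le; [exact: leq_addr|exact: chunk_slot_lt].
  - have aux i i' z : (st j i < st j i')%N -> lo i <= z -> z <= hi i' -> False.
      move=> ss h1 h2.
      have : dl (64 * st j i')%N < dl (64 * st j i + 63)%N.
        by apply: dl_dec; have := st_lt j i'; lia.
      by rewrite ltNge (le_trans h1 h2).
    move=> i i' z /andP[h1 h2] /andP[h3 h4]; apply: (st_inj j).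
    case: (ltngtP (st j i) (st j i')) => // c.
      by case: (aux i i' z c h1 h4).
    by case: (aux i' i z c h3 h2).
  - move=> i i'; rewrite /le; case: (ltrgtP (len i) (len i')) => //= _.
    exact: leq_total.
  - move=> i i'; rewrite /le; case: (ltrgtP (len i) (len i')) => //= _ h1 h2.
    by apply: ord_inj; apply/eqP; rewrite eqn_leq h1.
  - by move=> i i'; rewrite /le => /orP[/ltW//|/andP[/eqP e _]]; rewrite -/(len i) e.
  - move=> t; rewrite /diff_cf /chunk_cf avg_pair avg_pair; apply: eq_avg => i.
    apply: eq_avg => bb.
    transitivity (avg (fun _ : 'I_m' => avg (fun x0 : 'I_n * 'I_n =>
       cos (dl (64 * st j i + bb)%N * (a x0.1 - a x0.2) * t)))).
      by apply: eq_avg => c; apply: eq_avg => y; rewrite gapE.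
    by rewrite avg_cst// card_ord.
apply: (le_trans (perm_sum_anticoncentration a_inj p_inj h0 L0 hn gap_neq0 rho_ge x)).
have sq : Num.sqrt #|L|%:R = 8 * Num.sqrt (K2%:R * m'%:R) :> R.
  have -> : #|L|%:R = 8 ^+ 2 * (K2%:R * m'%:R) :> R.
    by rewrite cL !natrM -natrX; ring.
  by rewrite [LHS]sqrtrM ?sqr_ge0// sqrtr_sqr ger0_norm.
have sq3 : Num.sqrt (K2%:R ^+ 3 * m'%:R) = K2%:R * Num.sqrt (K2%:R * m'%:R) :> R.
  have -> : K2%:R ^+ 3 * m'%:R = K2%:R ^+ 2 * (K2%:R * m'%:R) :> R by ring.
  by rewrite [LHS]sqrtrM ?sqr_ge0// sqrtr_sqr ger0_norm.
rewrite sq sq3 natrM.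
have s0 : 0 < Num.sqrt (K2%:R * m'%:R) :> R by rewrite sqrtr_gt0 mulr_gt0 ?ltr0n.
move: s0; set s := Num.sqrt _ => s0.
have K0 : 0 < K2%:R :> R by rewrite ltr0n.
have N0 : 0 < n%:R :> R by rewrite ltr0n.
have -> : 16 * (257 / (K2%:R * n%:R)) / (8 * s) = 514 / (n%:R * (K2%:R * s)) :> R.
  by field; rewrite !gt_eqF.
apply: ler_wpM2r; first by rewrite invr_ge0 !mulr_ge0// ltW.
by rewrite !exprS expr0; lra.
Qed.
End ChunkCase.

Section SingleCase.
Variables (m' : nat) (co : 'I_h -> 'I_m' -> nat).
Hypotheses (m'0 : (0 < m')%N).
Hypothesis co_lt : forall j c, (co j c < m)%N.
Hypothesis co_inj : forall j c j' c', co j c = co j' c' -> j = j' /\ c = c'.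

Lemma single_slot_lt : (0 < K)%N.
Proof. by case/andP: ks => k0 _; case: k k0 => // k' _ /=; rewrite uphalfE. Qed.

(** Only the outermost pair of values is used, so that all pairs share the gap [dl 0]; this loses a
    constant factor when k is bounded. *)
Lemma single_case x :
  prob_eq (perm_sum a b) x <= 2 ^+ 5 / (n%:R * Num.sqrt (m'%:R)).
Proof.
have n0 := gap_n_gt0; have [q [dl [q_inj qgap dl0 dl_dec]]] := gap_data ks.
pose p (u : ('I_h * 'I_m') * bool) : 'I_n :=
  q ((Ordinal single_slot_lt, Ordinal (co_lt u.1.1 u.1.2)), u.2).
have p_inj : injective p.
  move=> [[j c] e] [[j' c'] e'] /q_inj [] /= E2 ->.
  by have [-> ->] := co_inj E2.
have gapE s : pair_gap b p s = dl 0%N by rewrite /pair_gap /p qgap.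
have h0 : (0 < h)%N by rewrite !muln_gt0 l0.
have L0 : (0 < #|'I_m'|)%N by rewrite card_ord.
have gap_neq0 s : pair_gap b p s != 0 by rewrite gapE gt_eqF// dl0// single_slot_lt.
have N0 : 0 < n%:R :> R by rewrite ltr0n.
have rho_ge j : mean (fun t => lazy_cf a (fun l => pair_gap b p (j, l)) t ^+ h) <= 2 / n%:R.
  have dn0 : dl 0%N != 0 by rewrite gt_eqF// dl0// single_slot_lt.
  apply: (le_trans (mean_lazy_cf_single n0 L0 a_inj dn0 (fun c => gapE (j, c)) h)).
  have h1 : (3 / 4) ^+ h <= (n%:R ^+ 2)^-1 :> R.
    apply: le_trans lazy_decay; apply: (@le_trans _ _ ((7 / 8) ^+ h)).
      by rewrite ler_pXn2r// ?nnegrE; lra.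
    by apply: ler_wiXn2l; rewrite ?leq_pmull//; lra.
  have h2 : (n%:R ^+ 2)^-1 <= n%:R^-1 :> R.
    rewrite lef_pV2 ?posrE ?exprn_gt0// expr2 ler_peMl ?ler0n// ler1n//.
  by move: h1 h2; move: (n%:R^-1) (_^-1) => u v; lra.
apply: (le_trans (perm_sum_anticoncentration a_inj p_inj h0 L0 hn gap_neq0 rho_ge x)).
rewrite card_ord.
have s0 : 0 < Num.sqrt (m'%:R) :> R by rewrite sqrtr_gt0 ltr0n.
move: s0; set s := Num.sqrt _ => s0.
have -> : 16 * (2 / n%:R) / s = 32 / (n%:R * s) :> R by field; rewrite !gt_eqF.
apply: ler_wpM2r; first by rewrite invr_ge0 !mulr_ge0// ltW.
by rewrite !exprS expr0; lra.
Qed.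
End SingleCase.
End GapCases.

(** * Case analysis and bookkeeping of constants *)

Section Assembly.
Variable R : realType.

Lemma eq_ler (x y : R) : x = y -> x <= y.
Proof. by move=> ->. Qed.

(** Passing from N to M under the square root costs the square root of their ratio, so the exponents
    are compared after squaring. *)
Lemma polylog_conclude (n l M : nat) (N : R) (e f g g' E F : nat) (P : R) :
  (0 < n)%N -> (0 < l)%N -> (0 < M)%N -> 0 < N ->
  M%:R <= 2 ^+ e * l%:R ^+ f * N ->
  P <= 2 ^+ g * l%:R ^+ g' / (n%:R * Num.sqrt N) ->
  (e + g.*2 <= E.*2)%N -> (f + g'.*2 <= F.*2)%N ->
  P <= 2 ^+ E * l%:R ^+ F / (n%:R * Num.sqrt M%:R).
Proof.
move=> n0 l0 M0 N0 MN PN eg fg; apply: (le_trans PN).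
have sN : 0 < Num.sqrt N by rewrite sqrtr_gt0.
have sM : 0 < Num.sqrt M%:R :> R by rewrite sqrtr_gt0 ltr0n.
have nn : 0 < n%:R :> R by rewrite ltr0n.
have l1 : 1 <= l%:R :> R by rewrite ler1n.
have l00 : 0 <= l%:R :> R by rewrite ler0n.
rewrite !invfM ![n%:R^-1 * _]mulrC !mulrA; apply: ler_wpM2r; first by rewrite invr_ge0 ltW.
rewrite ler_pdivrMr// mulrAC ler_pdivlMr//.
rewrite -(@ler_pXn2r _ 2) ?nnegrE ?mulr_ge0 ?exprn_ge0 ?(ltW sN) ?(ltW sM)//.
rewrite !exprMn !sqr_sqrtr ?ler0n ?(ltW N0)// -!exprM !muln2.
apply: (@le_trans _ _ (2 ^+ g.*2 * l%:R ^+ g'.*2 * (2 ^+ e * l%:R ^+ f * N))).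
  by apply: ler_wpM2l; rewrite ?mulr_ge0 ?exprn_ge0.
have -> : 2 ^+ g.*2 * l%:R ^+ g'.*2 * (2 ^+ e * l%:R ^+ f * N) =
    2 ^+ (e + g.*2) * l%:R ^+ (f + g'.*2) * N by rewrite !exprD; ring.
apply: ler_wpM2r; first exact: ltW.
apply: ler_pM; rewrite ?exprn_ge0//; first by apply: ler_weXn2l => //; rewrite ler1n.
exact: ler_weXn2l.
Qed.

Lemma mixed_radix_lt (p q j i : nat) : (j < p -> i < q -> j * q + i < p * q)%N.
Proof.
move=> jp iq; apply: (@leq_trans (j.+1 * q)); last by rewrite leq_mul2r jp orbT.
by rewrite mulSn addnC ltn_add2r.
Qed.

Lemma prob_eq_le1 n (X : 'S_n -> R) x : prob_eq X x <= 1.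
Proof. by rewrite prob_eqE; apply: avg_le => // pi; rewrite lern1 leq_b1. Qed.

Section Main.
Variables (n l : nat) (a b : 'I_n -> R).
Local Notation mu := (mult_profile b).
Hypotheses (a_inj : injective a) (l0 : (0 < l)%N) (nl : (n < 2 ^ l)%N).
Hypotheses (n0 : (0 < n)%N) (M0 : (0 < Mprof b)%N).

(** Here the most frequent value fills at least half of b, and another value exists. *)
Lemma small_profile x : (1 < size mu)%N -> (2 * Mprof b < n)%N ->
  prob_eq (perm_sum a b) x <= 2 / n%:R.
Proof.
move=> s1 Mn; have tail := Mprof_ge_tail b.
have : nth 0%N mu 0 \in mu by rewrite mem_nth// ltnW.
rewrite (perm_mem (perm_mult_profile b)) => /mapP[v _ ev].
have [p0 bp0] : exists p0, b p0 != v.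
  apply/existsP; apply: contraT => /existsPn H; move: s1.
  rewrite (perm_size (perm_mult_profile b)) size_map.
  have sub : {subset distinct_vals b <= [:: v]}.
    by move=> u; rewrite mem_undup => /codomP[i ->]; rewrite inE; have := H i; rewrite negbK.
  have := uniq_leq_size (undup_uniq _) sub; rewrite /= => h1 h2.
  by have := leq_trans h2 h1.
rewrite count_codom in ev.
have c0 : (n <= 2 * #|[pred r | b r == v]|)%N by rewrite -ev; lia.
have c1 : (0 < #|[pred r | b r == v]|)%N by lia.
apply: (le_trans (dominant_value_bound a_inj bp0 x c1)).
rewrite ler_pdivlMr ?ltr0n// mulrC ler_pdivrMr ?ltr0n//.
by rewrite -natrM ler_nat.
Qed.

(** If m >= h the copies are dealt to the groups, otherwise whole chunks of gaps are. With too few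
    gaps for a chunk only the widest is used; in the remaining cases n or M(B) is at most a constant
    times a power of l. *)
Lemma prob_eq_bound x :
  prob_eq (perm_sum a b) x <=
  2 ^+ 75 * l%:R ^+ 8 / (n%:R * Num.sqrt (Mprof b)%:R).
Proof.
have [k ks Mk] := dominant_level nl M0.
set m := nth 0%N mu k in Mk; pose K := k.+1./2.
have kn : (k <= n)%N.
  by case/andP: ks => _ /ltnW h; apply: leq_trans h (size_mult_profile b).
have mn : (m <= n)%N := mult_profile_le b k.
have kK : (k <= 2 * K)%N by rewrite /K; lia.
have Kk : (K <= k)%N by rewrite /K; case/andP: ks => k0 _; lia.
set h := (8 * (12 * l))%N.
have nn : 0 < n%:R :> R by rewrite ltr0n.
have l1 : 1 <= l%:R :> R by rewrite ler1n.
(* The trivial bound P <= 1, put in the shape of [polylog_conclude] with N = 1. *)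
have one_le (g g' : nat) : n%:R <= 2 ^+ g * l%:R ^+ g' :> R ->
    prob_eq (perm_sum a b) x <= 2 ^+ g * l%:R ^+ g' / (n%:R * Num.sqrt 1).
  move=> ng; apply: (le_trans (prob_eq_le1 _ x)).
  by rewrite sqrtr1 mulr1 ler_pdivlMr// mul1r.
have MR (kb mb : R) : k%:R <= kb -> m%:R <= mb -> (Mprof b)%:R <= l%:R * (kb ^+ 3 * mb).
  move=> hk hm; apply: (@le_trans _ _ (l * (k ^ 3 * m))%:R); first by rewrite ler_nat.
  rewrite natrM natrM natrX; apply: ler_wpM2l => //; apply: ler_pM => //.
  by rewrite ler_pXn2r ?nnegrE// (le_trans _ hk).
have [hn|hn] := leqP (8 * h ^ 2)%N n; last first.
  have n17 : n%:R <= 2 ^+ 17 * l%:R ^+ 2 :> R.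
    apply: (@le_trans _ _ (8 * h ^ 2)%:R); first by rewrite ler_nat ltnW.
    have -> : (8 * h ^ 2)%:R = 8 * 96 ^+ 2 * l%:R ^+ 2 :> R.
      by rewrite natrM natrX /h !natrM; ring.
    apply: ler_wpM2r; first exact: exprn_ge0.
    by rewrite !exprS expr0; lra.
  apply: (@polylog_conclude n l _ 1 68 9 17 2 75 8) => //; last exact: one_le.
  rewrite mulr1; apply: (le_trans (MR n%:R n%:R _ _)); rewrite ?ler_nat//.
  rewrite -exprSr.
  apply: (@le_trans _ _ (l%:R * (2 ^+ 17 * l%:R ^+ 2) ^+ 4)).
    by apply: ler_wpM2l => //; rewrite ler_pXn2r ?nnegrE ?mulr_ge0 ?exprn_ge0.
  by move: (2 : R) (l%:R : R) => w v; apply: eq_ler; ring.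
have h0 : (0 < h)%N by rewrite !muln_gt0 l0.
have [mh|mh] := leqP h m.
  set m' := (m %/ h)%N.
  have m'0 : (0 < m')%N by rewrite divn_gt0.
  have mm' : (m <= 192 * l * m')%N.
    by have := ltn_ceil m h0; rewrite -/m' /h; nia.
  have m'h : (h * m' <= m)%N by rewrite mulnC leq_trunc_div.
  have mR : m%:R <= 2 ^+ 8 * l%:R * m'%:R :> R.
    apply: (@le_trans _ _ (192 * l * m')%:R); first by rewrite ler_nat.
    rewrite natrM natrM; do 2 (apply: ler_wpM2r; first exact: ler0n).
    by rewrite !exprS expr0; lra.
  pose co (j : 'I_h) (c : 'I_m') := (j * m' + c)%N.
  have co_lt j c : (co j c < m)%N.
    by apply: leq_trans m'h; apply: mixed_radix_lt.
  have co_inj j c j' c' : co j c = co j' c' -> j = j' /\ c = c'.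
    rewrite /co => E; have lc := ltn_ord c; have lc' := ltn_ord c'.
    have ej : j = j' :> nat.
      by have := congr1 (fun u => u %/ m')%N E; rewrite !divnMDl// !divn_small// !addn0.
    by split; apply: ord_inj => //; move: E; rewrite ej => /addnI.
  (* All groups use the same K / 64 chunks, in different copies. *)
  have [K64|K64] := leqP 64 K.
    set K2 := (K %/ 64)%N.
    have K20 : (0 < K2)%N by rewrite divn_gt0.
    have K2K : (K2 * 64 <= K)%N by rewrite leq_trunc_div.
    have kK2 : (k <= 256 * K2)%N.
      by have := @ltn_ceil K 64 isT; rewrite -/K2; lia.
    have K2n : (K2 <= n)%N by lia.
    apply: (@polylog_conclude n l _ (K2%:R ^+ 3 * m'%:R) 32 2 10 0 75 8) => //.
    - by rewrite mulr_gt0 ?exprn_gt0 ?ltr0n.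
    - apply: (le_trans (MR (2 ^+ 8 * K2%:R) _ _ mR)); last first.
        by move: (2 : R) (l%:R : R) (K2%:R : R) (m'%:R : R) => w u v z; apply: eq_ler; ring.
      by rewrite -natrX -natrM ler_nat.
    rewrite expr0 mulr1.
    apply: (@chunk_case _ _ l k a b a_inj l0 nl ks hn K2 m' (fun _ i => i) co) => //.
      by move=> j i; have := ltn_ord i; rewrite -/K; lia.
    by move=> j i c j' i' c' /ord_inj -> /co_inj[-> ->].
  apply: (@polylog_conclude n l _ m'%:R 29 2 5 0 75 8) => //.
  - by rewrite ltr0n.
  - apply: (le_trans (MR (2 ^+ 7) _ _ mR)); last first.
      by move: (2 : R) (l%:R : R) (m'%:R : R) => w u z; apply: eq_ler; ring.
    by rewrite -natrX ler_nat; lia.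
  rewrite expr0 mulr1.
  exact: (@single_case _ _ l k a b a_inj l0 nl ks hn m' co).
have mR : m%:R <= 2 ^+ 7 * l%:R :> R.
  by rewrite -natrX -natrM ler_nat; move: mh; rewrite /h; lia.
(* Too few copies to share: each group gets its own chunks, in a single copy. *)
have [K64|K64] := leqP (64 * h)%N K.
  set K2 := (K %/ (64 * h))%N.
  have h64 : (0 < 64 * h)%N by rewrite muln_gt0.
  have K20 : (0 < K2)%N by rewrite divn_gt0.
  have K2K : (K2 * (64 * h) <= K)%N by rewrite leq_trunc_div.
  have kK2 : (k <= 256 * (96 * l) * K2)%N.
    have := ltn_ceil K h64; rewrite -/K2 => hK.
    have : (K <= 2 * K2 * (64 * h))%N by apply: leq_trans (ltnW hK) _; rewrite leq_mul2r; apply/orP; right; lia.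
    by move: kK; rewrite /h; lia.
  have K2n : (K2 <= n)%N by nia.
  have mpos : (0 < m)%N.
    by rewrite lt0n; apply: contraTneq M0 => m0; rewrite m0 !muln0 leqn0 in Mk; rewrite (eqP Mk).
  apply: (@polylog_conclude n l _ (K2%:R ^+ 3 * 1%:R) 52 5 10 0 75 8) => //.
  - by rewrite mulr_gt0 ?exprn_gt0 ?ltr0n.
  - apply: (le_trans (MR (2 ^+ 15 * l%:R * K2%:R) _ _ mR)); last first.
      by move: (2 : R) (l%:R : R) (K2%:R : R) => w u v; apply: eq_ler; ring.
    apply: (@le_trans _ _ (256 * (96 * l) * K2)%:R); first by rewrite ler_nat.
    have -> : (256 * (96 * l) * K2)%:R = 2 ^+ 8 * 96 * l%:R * K2%:R :> R.
      by rewrite !natrM; ring.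
    do 2 (apply: ler_wpM2r; first exact: ler0n).
    by rewrite !exprS expr0; lra.
  rewrite expr0 mulr1.
  apply: (@chunk_case _ _ l k a b a_inj l0 nl ks hn K2 1 (fun j i => j * K2 + i)%N (fun _ _ => 0%N)) => //.
    move=> j i; have := ltn_ord i; have := ltn_ord j; rewrite -/K -/h => lj li.
    have e1 : (j * K2 + i < h * K2)%N by exact: mixed_radix_lt.
    have e2 : (K2 * (64 * h) = 64 * (h * K2))%N by rewrite mulnCA [(K2 * h)%N]mulnC.
    by apply: leq_trans K2K; rewrite e2; move: e1; move: (h * K2)%N (j * K2 + i)%N => u v; lia.
  move=> j i c j' i' c' E _; rewrite (ord1 c) (ord1 c').
  have ej : j = j' :> nat.
    by have := congr1 (fun u => u %/ K2)%N E; rewrite !divnMDl// !divn_small// !addn0.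
  by split; apply: ord_inj => //; move: E; rewrite ej => /addnI.
(* Now k and m are both O(l), hence M(B) = O(l^5). *)
have M49 : (Mprof b)%:R <= 2 ^+ 49 * l%:R ^+ 5 * 1 :> R.
  apply: (le_trans (MR (2 ^+ 14 * l%:R) _ _ mR)); last first.
    by move: (2 : R) (l%:R : R) => w u; apply: eq_ler; ring.
  apply: (@le_trans _ _ (2 * 64 * h)%:R); first by rewrite ler_nat; lia.
  have -> : (2 * 64 * h)%:R = 2 ^+ 7 * 96 * l%:R :> R by rewrite !natrM; ring.
  apply: ler_wpM2r; first exact: ler0n.
  by rewrite !exprS expr0; lra.
have [big|small] := leqP n (2 * Mprof b)%N.
  (* This case fixes the exponents 75 and 8: 49 + 100 <= 150 and 5 + 10 <= 16. *)
  apply: (@polylog_conclude n l _ 1 49 5 50 5 75 8) => //; apply: one_le.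
  apply: (@le_trans _ _ (2 * Mprof b)%:R); first by rewrite ler_nat.
  by rewrite natrM exprS -mulrA; apply: ler_wpM2l => //; rewrite mulr1 in M49.
apply: (@polylog_conclude n l _ 1 49 5 1 0 75 8) => //.
have -> : 2 ^+ 1 * l%:R ^+ 0 / (n%:R * Num.sqrt 1) = 2 / n%:R :> R.
  by rewrite expr0 expr1 sqrtr1 !mulr1.
apply: small_profile => //.
by case/andP: ks; exact: leq_ltn_trans.
Qed.

End Main.
End Assembly.

(** * Powers of the logarithm against powers of n *)

Section LogPower.
Variable R : realType.

(** With d = eps / 8, log n is at most n^d / d; take eighth powers. *)
Lemma trunc_log_le_powR (eps : R) : 0 < eps -> exists C : R, 0 <= C /\
  forall n, (0 < n)%N -> (trunc_log 2 n).+1%:R ^+ 8 <= C * n%:R `^ eps.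
Proof.
move=> e0; pose d := eps / 8.
have d0 : 0 < d by rewrite divr_gt0.
have ln2 : 0 < ln 2 :> R by rewrite ln_gt0// ltr1n.
pose c := 1 + (d * ln 2)^-1.
have c0 : 0 <= c by rewrite addr_ge0// invr_ge0 mulr_ge0// ltW.
exists (c ^+ 8); split; first exact: exprn_ge0.
move=> n n0; have N0 : 0 < n%:R :> R by rewrite ltr0n.
have N1 : 1 <= n%:R :> R by rewrite ler1n.
have -> : n%:R `^ eps = (n%:R `^ d) ^+ 8 :> R.
  by rewrite -powR_mulrn ?powR_ge0// -powRrM /d divfK.
rewrite -exprMn ler_pXn2r ?nnegrE ?mulr_ge0 ?powR_ge0//.
have p1 : 1 <= n%:R `^ d by rewrite -[leLHS](powRr0 n%:R) ler_powR// ltW.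
have lnn : d * ln n%:R <= n%:R `^ d.
  by rewrite -ln_powR; apply: ltW; apply: ln_sublinear; exact: powR_gt0.
have tl : (trunc_log 2 n)%:R * ln 2 <= ln n%:R :> R.
  rewrite -ln_powR ler_ln ?posrE ?powR_gt0// powR_mulrn// -natrX ler_nat.
  exact: trunc_logP.
rewrite -natr1 /c mulrDl mul1r addrC; apply: lerD => //.
rewrite mulrC ler_pdivlMr ?mulr_gt0//.
apply: le_trans lnn; rewrite mulrCA; apply: ler_wpM2l => //; exact: ltW.
Qed.
End LogPower.

Theorem theorem1p2 (R : realType) (eps : R) (heps : 0 < eps) :
  exists C : R, forall (n : nat) (a b : 'I_n -> R),
    (1 <= n)%N -> injective a -> (0 < Mprof b)%N ->
    Qconc (perm_sum a b) <=
      C * (n%:R `^ (eps - 1)) / Num.sqrt ((Mprof b)%:R).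
Proof.
have [C [C0 HC]] := trunc_log_le_powR heps.
exists (2 ^+ 75 * C) => n a b n0 a_inj M0.
apply: ge_sup; first by exists (prob_eq (perm_sum a b) 0), 0.
move=> _ [x _ <-].
(* l is one more than the integer part of the binary logarithm, so that n < 2^l; its eighth power is
   absorbed by n^eps. *)
apply: (le_trans (@prob_eq_bound R n (trunc_log 2 n).+1 a b a_inj isT (@trunc_log_ltn 2 n isT) n0 M0 x)).
have N0 : 0 < n%:R :> R by rewrite ltr0n.
have sM : 0 < Num.sqrt (Mprof b)%:R :> R by rewrite sqrtr_gt0 ltr0n.
have -> : n%:R `^ (eps - 1) = n%:R `^ eps / n%:R :> R.
  rewrite powRD; last by rewrite (gt_eqF N0) implybT.
  by rewrite powR_inv1// ltW.
move: (_.+1%:R ^+ 8) (HC n n0) => P hP.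
rewrite invfM !mulrA; apply: ler_wpM2r; first by rewrite invr_ge0 ltW.
apply: ler_wpM2r; first by rewrite invr_ge0 ltW.
by rewrite -[leRHS]mulrA; apply: ler_wpM2l; first exact: exprn_ge0.
Qed.
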